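(* The Lie algebra $\mathcal O$ has a presentation by generators $\mathcal W_0$, $\mathcal W_1$, $\lbrace\mathcal G_{k+1}\rbrace_{k\in\mathbb N}$ and the following relations: \begin{align*} &[\mathcal W_0,[\mathcal W_0,[\mathcal W_0,\mathcal W_1]]]=4[\mathcal W_0,\mathcal W_1],\\ &[\mathcal W_1,[\mathcal W_1,[\mathcal W_1,\mathcal W_0]]]=4[\mathcal W_1,\mathcal W_0],\\ &[\mathcal W_1,[\mathcal W_1,\mathcal W_0]]=[\mathcal W_1,\mathcal G_1],\\ &[[\mathcal W_1,\mathcal W_0],\mathcal W_0]=[\mathcal G_1,\mathcal W_0],\\ &[\mathcal W_1,[\mathcal W_1,[\mathcal W_0,\mathcal G_k]]]=4[\mathcal W_1,\mathcal G_{k+1}]\qquad (k\in\mathbb N^+),\\ &[[[\mathcal G_k,\mathcal W_1],\mathcal W_0],\mathcal W_0]=4[\mathcal G_{k+1},\mathcal W_0]\qquad (k\in\mathbb N^+),\\ &[\mathcal G_{k+1},\mathcal G_{\ell+1}]=0\qquad (k,\ell\in\mathbb N). \end{align*}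
   Context: $\mathbb F$ is a field of characteristic zero; all vector spaces and Lie algebras are over $\mathbb F$. $\mathbb N=\{0,1,2,\ldots\}$ and $\mathbb N^+=\{1,2,3,\ldots\}$. $\mathbb F[t,t^{-1}]$ is the algebra of Laurent polynomials. $L(\mathfrak{gl}_2)=\mathfrak{gl}_2\otimes\mathbb F[t,t^{-1}]$ is the loop algebra, with Lie bracket $[u\otimes\varphi,v\otimes\phi]=[u,v]\otimes\varphi\phi$; its elements are viewed as $2\times 2$ matrices with entries in $\mathbb F[t,t^{-1}]$, with bracket $[x,y]=xy-yx$. For $x=\begin{pmatrix} a(t)&b(t)\\ c(t)&d(t)\end{pmatrix}\in L(\mathfrak{gl}_2)$ define $\theta(x)=\begin{pmatrix} d(t^{-1})&c(t^{-1})\\ b(t^{-1})&a(t^{-1})\end{pmatrix}$ and $\varepsilon(x)=a(1)+d(1)\in\mathbb F$. Then $\theta$ is a Lie algebra automorphism of $L(\mathfrak{gl}_2)$ and $\varepsilon:L(\mathfrak{gl}_2)\to\mathbb F$ is a Lie algebra homomorphism ($\mathbb F$ abelian). Let $\mathcal L=\ker\varepsilon$, and let $\mathcal O$ be the Lie algebra of all elements of $\mathcal L$ fixed by $\theta$. In $\mathcal O$ define $$\mathcal W_0=\begin{pmatrix}0&1\\1&0\end{pmatrix},\qquad \mathcal W_1=\begin{pmatrix}0&t\\t^{-1}&0\end{pmatrix},\qquad \mathcal G_{k+1}=\Bigl(\tfrac{t+t^{-1}}{2}\Bigr)^k\begin{pmatrix}2t-2&0\\0&2t^{-1}-2\end{pmatrix}\quad(k\in\mathbb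 N).$$ ''$\mathcal O$ has a presentation by given generators and relations'' means: the Lie algebra over $\mathbb F$ defined abstractly by these generators and relations is isomorphic to $\mathcal O$ via the Lie algebra homomorphism sending each abstract generator to the element of $\mathcal O$ with the same name. *)

(* Defs.v *)
From HB Require Import structures.
From mathcomp Require Import all_boot all_algebra generic_quotient boolp finmap.
From mathcomp Require Import monalg.

Set Implicit Arguments.
Unset Strict Implicit.
Unset Printing Implicit Defensive.

Import GRing.Theory.

Local Open Scope ring_scope.
Local Open Scope quotient_scope.

HB.mixin Record Lmodule_isLieAlgebra (F : fieldType) L of GRing.Lmodule F L := {
  lie : L -> L -> L;
  lieDl : forall x y z, lie (x + y) z = lie x z + lie y z;
  lieDr : forall x y z, lie x (y + z) = lie x y + lie x z;
  lieZl : forall a x y, lie (a *: x) y = a *: lie x y;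
  lieZr : forall a x y, lie x (a *: y) = a *: lie x y;
  liexx : forall x, lie x x = 0;
  lie_jacobi : forall x y z,
    lie x (lie y z) + lie y (lie z x) + lie z (lie x y) = 0
}.

#[short(type="lieAlgType")]
HB.structure Definition LieAlgebra (F : fieldType) :=
  { L of GRing.Lmodule F L & Lmodule_isLieAlgebra F L }.

Definition lie_morphism (F : fieldType) (L M : lieAlgType F)
    (phi : {linear L -> M}) : Prop :=
  forall x y, phi (lie x y) = lie (phi x) (phi y).

Inductive lie_term (F : fieldType) (X : Type) : Type :=
| LGen of X
| LZero
| LAdd of lie_term F X & lie_term F X
| LOpp of lie_term F X
| LScale of F & lie_term F X
| LBr of lie_term F X & lie_term F X.

Arguments LGen {F X}.
Arguments LZero {F X}.

HB.instance Definition _ (F : fieldType) (X : Type) :=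
  gen_eqMixin (lie_term F X).
HB.instance Definition _ (F : fieldType) (X : Type) :=
  gen_choiceMixin (lie_term F X).

(* The least congruence on terms that contains the axioms of Lie algebras
   over F and the pairs related by rel. *)
Inductive lie_cong (F : fieldType) (X : Type)
    (rel : lie_term F X -> lie_term F X -> Prop) :
    lie_term F X -> lie_term F X -> Prop :=
| lc_rel u v : rel u v -> lie_cong rel u v
| lc_refl u : lie_cong rel u u
| lc_sym u v : lie_cong rel u v -> lie_cong rel v u
| lc_trans v u w : lie_cong rel u v -> lie_cong rel v w -> lie_cong rel u w
| lc_add u u' v v' : lie_cong rel u u' -> lie_cong rel v v' ->
    lie_cong rel (LAdd u v) (LAdd u' v')
| lc_opp u u' : lie_cong rel u u' -> lie_cong rel (LOpp u) (LOpp u')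
| lc_scale a u u' : lie_cong rel u u' ->
    lie_cong rel (LScale a u) (LScale a u')
| lc_br u u' v v' : lie_cong rel u u' -> lie_cong rel v v' ->
    lie_cong rel (LBr u v) (LBr u' v')
| lc_addA u v w : lie_cong rel (LAdd u (LAdd v w)) (LAdd (LAdd u v) w)
| lc_addC u v : lie_cong rel (LAdd u v) (LAdd v u)
| lc_add0 u : lie_cong rel (LAdd LZero u) u
| lc_addN u : lie_cong rel (LAdd (LOpp u) u) LZero
| lc_scaleA a b u : lie_cong rel (LScale a (LScale b u)) (LScale (a * b) u)
| lc_scale1 u : lie_cong rel (LScale 1 u) u
| lc_scaleDr a u v :
    lie_cong rel (LScale a (LAdd u v)) (LAdd (LScale a u) (LScale a v))
| lc_scaleDl a b u :
    lie_cong rel (LScale (a + b) u) (LAdd (LScale a u) (LScale b u))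
| lc_brDl u v w : lie_cong rel (LBr (LAdd u v) w) (LAdd (LBr u w) (LBr v w))
| lc_brDr u v w : lie_cong rel (LBr u (LAdd v w)) (LAdd (LBr u v) (LBr u w))
| lc_brZl a u v : lie_cong rel (LBr (LScale a u) v) (LScale a (LBr u v))
| lc_brZr a u v : lie_cong rel (LBr u (LScale a v)) (LScale a (LBr u v))
| lc_brxx u : lie_cong rel (LBr u u) LZero
| lc_jacobi u v w :
    lie_cong rel (LAdd (LAdd (LBr u (LBr v w)) (LBr v (LBr w u)))
                       (LBr w (LBr u v))) LZero.

Section PresentedLie.
Variables (F : fieldType) (X : Type).
Variable rel : lie_term F X -> lie_term F X -> Prop.
Implicit Types u v w : lie_term F X.

Definition lie_congb u v : bool := `[< lie_cong rel u v >].

Lemma lie_congb_refl : reflexive lie_congb.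
Proof. by move=> u; apply/asboolP; apply: lc_refl. Qed.

Lemma lie_congb_sym : symmetric lie_congb.
Proof. by move=> u v; apply/asboolP/asboolP; apply: lc_sym. Qed.

Lemma lie_congb_trans : transitive lie_congb.
Proof.
by move=> v u w /asboolP uv /asboolP vw; apply/asboolP; apply: lc_trans uv vw.
Qed.

Canonical lie_congb_equiv :=
  EquivRel lie_congb lie_congb_refl lie_congb_sym lie_congb_trans.

Definition presented_lie : Type := {eq_quot lie_congb}.

HB.instance Definition _ := Choice.on presented_lie.
HB.instance Definition _ := EqQuotient.on presented_lie.

Implicit Types x y z : presented_lie.

Definition pl_class u : presented_lie := \pi_presented_lie u.
Definition pl_repr x : lie_term F X := repr x.

Lemma pl_reprK x : pl_class (pl_repr x) = x.
Proof. exact: reprK. Qed.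

Lemma pl_classP u v : pl_class u = pl_class v <-> lie_cong rel u v.
Proof.
split=> [/eqquotP/asboolP //|uv].
by apply/eqquotP/asboolP.
Qed.

Lemma pl_classK u : lie_cong rel (pl_repr (pl_class u)) u.
Proof. by apply/pl_classP; rewrite pl_reprK. Qed.

Definition pl_gen (g : X) : presented_lie := pl_class (LGen g).
Definition pl_zero : presented_lie := pl_class LZero.
Definition pl_add x y := pl_class (LAdd (pl_repr x) (pl_repr y)).
Definition pl_opp x := pl_class (LOpp (pl_repr x)).
Definition pl_scale a x := pl_class (LScale a (pl_repr x)).
Definition pl_br x y := pl_class (LBr (pl_repr x) (pl_repr y)).

Lemma pl_addE u v : pl_add (pl_class u) (pl_class v) = pl_class (LAdd u v).
Proof. by apply/pl_classP/lc_add; apply: pl_classK. Qed.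
Lemma pl_oppE u : pl_opp (pl_class u) = pl_class (LOpp u).
Proof. by apply/pl_classP/lc_opp; apply: pl_classK. Qed.
Lemma pl_scaleE a u : pl_scale a (pl_class u) = pl_class (LScale a u).
Proof. by apply/pl_classP/lc_scale; apply: pl_classK. Qed.
Lemma pl_brE u v : pl_br (pl_class u) (pl_class v) = pl_class (LBr u v).
Proof. by apply/pl_classP/lc_br; apply: pl_classK. Qed.

Let plE := (pl_addE, pl_oppE, pl_scaleE, pl_brE).

Lemma pl_addA : associative pl_add.
Proof.
move=> x y z; rewrite -[x]pl_reprK -[y]pl_reprK -[z]pl_reprK !plE.
exact/pl_classP/lc_addA.
Qed.

Lemma pl_addC : commutative pl_add.
Proof.
move=> x y; rewrite -[x]pl_reprK -[y]pl_reprK !plE; exact/pl_classP/lc_addC.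
Qed.

Lemma pl_add0 : left_id pl_zero pl_add.
Proof. by move=> x; rewrite -[x]pl_reprK !plE; exact/pl_classP/lc_add0. Qed.

Lemma pl_addN : left_inverse pl_zero pl_opp pl_add.
Proof. by move=> x; rewrite -[x]pl_reprK !plE; exact/pl_classP/lc_addN. Qed.

HB.instance Definition _ :=
  GRing.isZmodule.Build presented_lie pl_addA pl_addC pl_add0 pl_addN.

Lemma pl_scaleA a b x : pl_scale a (pl_scale b x) = pl_scale (a * b) x.
Proof. by rewrite -[x]pl_reprK !plE; exact/pl_classP/lc_scaleA. Qed.

Lemma pl_scale1 : left_id 1 pl_scale.
Proof. by move=> x; rewrite -[x]pl_reprK !plE; exact/pl_classP/lc_scale1. Qed.

Lemma pl_scaleDr : right_distributive pl_scale +%R.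
Proof.
move=> a x y; rewrite -[x]pl_reprK -[y]pl_reprK.
rewrite -[LHS]/(pl_scale a (pl_add _ _)) -[RHS]/(pl_add _ _) !plE.
exact/pl_classP/lc_scaleDr.
Qed.

Lemma pl_scaleDl x : {morph pl_scale^~ x : a b / a + b}.
Proof.
move=> a b; rewrite -[x]pl_reprK -[RHS]/(pl_add _ _) !plE.
exact/pl_classP/lc_scaleDl.
Qed.

HB.instance Definition _ :=
  GRing.Zmodule_isLmodule.Build F presented_lie
    pl_scaleA pl_scale1 pl_scaleDr pl_scaleDl.

Lemma pl_brDl x y z : pl_br (x + y) z = pl_br x z + pl_br y z.
Proof.
rewrite -[x]pl_reprK -[y]pl_reprK -[z]pl_reprK.
rewrite -[LHS]/(pl_br (pl_add _ _) _) -[RHS]/(pl_add _ _) !plE.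
exact/pl_classP/lc_brDl.
Qed.

Lemma pl_brDr x y z : pl_br x (y + z) = pl_br x y + pl_br x z.
Proof.
rewrite -[x]pl_reprK -[y]pl_reprK -[z]pl_reprK.
rewrite -[LHS]/(pl_br _ (pl_add _ _)) -[RHS]/(pl_add _ _) !plE.
exact/pl_classP/lc_brDr.
Qed.

Lemma pl_brZl a x y : pl_br (a *: x) y = a *: pl_br x y.
Proof.
rewrite -[x]pl_reprK -[y]pl_reprK.
rewrite -[LHS]/(pl_br (pl_scale _ _) _) -[RHS]/(pl_scale _ _) !plE.
exact/pl_classP/lc_brZl.
Qed.

Lemma pl_brZr a x y : pl_br x (a *: y) = a *: pl_br x y.
Proof.
rewrite -[x]pl_reprK -[y]pl_reprK.
rewrite -[LHS]/(pl_br _ (pl_scale _ _)) -[RHS]/(pl_scale _ _) !plE.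
exact/pl_classP/lc_brZr.
Qed.

Lemma pl_brxx x : pl_br x x = 0.
Proof. by rewrite -[x]pl_reprK !plE; exact/pl_classP/lc_brxx. Qed.

Lemma pl_jacobi x y z :
  pl_br x (pl_br y z) + pl_br y (pl_br z x) + pl_br z (pl_br x y) = 0.
Proof.
rewrite -[x]pl_reprK -[y]pl_reprK -[z]pl_reprK.
rewrite -[LHS]/(pl_add (pl_add _ _) _) !plE.
exact/pl_classP/lc_jacobi.
Qed.

HB.instance Definition _ :=
  Lmodule_isLieAlgebra.Build F presented_lie
    pl_brDl pl_brDr pl_brZl pl_brZr pl_brxx pl_jacobi.

End PresentedLie.

Definition has_presentation (F : fieldType) (X : Type)
    (rel : lie_term F X -> lie_term F X -> Prop)
    (L : lieAlgType F) (f : X -> L) : Prop :=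
  exists phi : {linear presented_lie rel -> L},
    [/\ lie_morphism phi,
        forall g : X, phi (pl_gen rel g) = f g
      & bijective phi].

Section UniversalProperty.
Variables (F : fieldType) (X : Type) (L : lieAlgType F) (f : X -> L).
Variable rel : lie_term F X -> lie_term F X -> Prop.

Fixpoint lie_eval (u : lie_term F X) : L :=
  match u with
  | LGen g => f g
  | LZero => 0
  | LAdd u v => lie_eval u + lie_eval v
  | LOpp u => - lie_eval u
  | LScale a u => a *: lie_eval u
  | LBr u v => lie (lie_eval u) (lie_eval v)
  end.

Hypothesis f_rel : forall u v, rel u v -> lie_eval u = lie_eval v.

Lemma lie_eval_cong u v : lie_cong rel u v -> lie_eval u = lie_eval v.
Proof.
elim=> {u v} //=.
- by move=> v u w _ -> _ ->.
- by move=> u u' v v' _ -> _ ->.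
- by move=> u u' _ ->.
- by move=> a u u' _ ->.
- by move=> u u' v v' _ -> _ ->.
- by move=> u v w; rewrite addrA.
- by move=> u v; rewrite addrC.
- by move=> u; rewrite add0r.
- by move=> u; rewrite addNr.
- by move=> a b u; rewrite scalerA.
- by move=> u; rewrite scale1r.
- by move=> a u v; rewrite scalerDr.
- by move=> a b u; rewrite scalerDl.
- by move=> u v w; rewrite lieDl.
- by move=> u v w; rewrite lieDr.
- by move=> a u v; rewrite lieZl.
- by move=> a u v; rewrite lieZr.
- by move=> u; rewrite liexx.
- by move=> u v w; rewrite lie_jacobi.
Qed.

Lemma pl_universal :
  exists phi : {linear presented_lie rel -> L},
    [/\ lie_morphism phi,
        forall g, phi (pl_gen rel g) = f g
      & forall psi : {linear presented_lie rel -> L},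
          lie_morphism psi -> (forall g, psi (pl_gen rel g) = f g) ->
          psi =1 phi].
Proof.
pose h (x : presented_lie rel) := lie_eval (pl_repr x).
have hE u : h (pl_class rel u) = lie_eval u.
  exact/lie_eval_cong/pl_classK.
have h_lin : linear h.
  move=> a x y; rewrite -[x]pl_reprK -[y]pl_reprK.
  rewrite -[X in h X]/(pl_add (pl_scale a _) _).
  by rewrite pl_scaleE pl_addE !hE.
pose hL := GRing.isLinear.Build F (presented_lie rel) L _ h h_lin.
pose phi : {linear presented_lie rel -> L} := HB.pack h hL.
exists phi; split=> [x y|g|psi psi_lie psi_gen x].
- by rewrite -[x]pl_reprK -[y]pl_reprK -[lie _ _]/(pl_br _ _) pl_brE /= !hE.
- exact: hE.
rewrite -[x]pl_reprK /= hE; elim: (pl_repr x) => {x} /=.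
- exact: psi_gen.
- exact: (linear0 psi).
- by move=> u <- v <-; rewrite -pl_addE; exact: (linearD psi).
- by move=> u <-; rewrite -pl_oppE; exact: (linearN psi).
- by move=> a u <-; rewrite -pl_scaleE; exact: (linearZ_LR psi).
- by move=> u <- v <-; rewrite -pl_brE; exact: psi_lie.
Qed.

End UniversalProperty.

(* Finitely supported functions int -> F; << a *g k >> is a t^k and p@_k is
   the coefficient of t^k.  The product of monalg is not available since int,
   being a group, is not one of its monomTypes. *)
Definition laurent (F : fieldType) : Type := {malg F[int]}.

HB.instance Definition _ (F : fieldType) := GRing.Lmodule.on (laurent F).

(* The linear map that sends t^k to h k. *)
HB.lock Definition lext (F : fieldType) (V : lmodType F) (h : int -> V)
    (p : laurent F) : V :=
  \sum_(k <- msupp p) p@_k *: h k.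

Section Laurent.
Variable F : fieldType.
Implicit Types (p q r : laurent F) (i j k : int).

Definition lmon k : laurent F := << 1 *g k >>.

Lemma lextE (V : lmodType F) (h : int -> V) p :
  lext h p = \sum_(k <- msupp p) p@_k *: h k.
Proof. by rewrite lext.unlock. Qed.

Lemma lextw (V : lmodType F) (h : int -> V) p (d : {fset int}) :
  (msupp p `<=` d)%fset -> lext h p = \sum_(k <- d) p@_k *: h k.
Proof.
move=> le; rewrite lextE (big_fset_incl _ le) //= => k _ /mcoeff_outdom ->.
by rewrite scale0r.
Qed.

Lemma lext_is_linear (V : lmodType F) (h : int -> V) : linear (lext h).
Proof.
move=> a p q.
pose d := (msupp p `|` msupp q)%fset.
have dp : (msupp p `<=` d)%fset by apply: fsubsetUl.
have dq : (msupp q `<=` d)%fset by apply: fsubsetUr.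
have dpq : (msupp (a *: p + q : {malg F[int]}) `<=` d)%fset.
  apply: fsubset_trans (msuppD_le _ _) _; apply: fsetSU; exact: msuppZ_le.
rewrite (lextw h dp) (lextw h dq) (lextw h dpq) scaler_sumr -big_split /=.
by apply: eq_bigr => k _; rewrite mcoeffD mcoeffZ scalerDl scalerA.
Qed.

HB.instance Definition _ (V : lmodType F) (h : int -> V) :=
  GRing.isLinear.Build F (laurent F) V _ (lext h) (lext_is_linear h).

Lemma lext_mon (V : lmodType F) (h : int -> V) k : lext h (lmon k) = h k.
Proof. by rewrite (lextw h msuppU_le) big_seq_fset1 mcoeffUU scale1r. Qed.

Lemma laurentE p : p = \sum_(k <- msupp p) p@_k *: lmon k.
Proof.
rewrite {1}[p]monalgE; apply: eq_bigr => k _; apply/malgP => i.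
by rewrite mcoeffZ !mcoeffU mulrnAr mulr1.
Qed.

Lemma laurent_ind (V : lmodType F) (f g : laurent F -> V) :
  linear f -> linear g -> (forall k, f (lmon k) = g (lmon k)) -> f =1 g.
Proof.
move=> fl gl fg p.
pose fL : {linear laurent F -> V} :=
  HB.pack f (GRing.isLinear.Build F (laurent F) V _ f fl).
pose gL : {linear laurent F -> V} :=
  HB.pack g (GRing.isLinear.Build F (laurent F) V _ g gl).
rewrite -[f]/(fL : _ -> _) -[g]/(gL : _ -> _) [p]laurentE !linear_sum.
by apply: eq_bigr => k _; rewrite !linearZ /= fg.
Qed.

Definition lmul p q : laurent F :=
  lext (fun i => lext (fun j => lmon (i + j)) q) p.

Lemma lmul_linl q : linear (lmul^~ q).
Proof. exact: lext_is_linear. Qed.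

Lemma lmul_linr p : linear (lmul p).
Proof.
move=> a q r; rewrite /lmul !(lextE _ p) scaler_sumr -big_split /=.
apply: eq_bigr => k _; rewrite linearP scalerDr.
by rewrite !scalerA mulrC.
Qed.

Lemma lmul_mon i j : lmul (lmon i) (lmon j) = lmon (i + j).
Proof. by rewrite /lmul !lext_mon. Qed.

Lemma lmulC : commutative lmul.
Proof.
move=> p q; move: p.
apply: (laurent_ind (lmul_linl q) (lmul_linr q)) => i; move: q.
apply: (laurent_ind (lmul_linr _) (lmul_linl _)) => j.
by rewrite !lmul_mon addrC.
Qed.

Lemma lmulA : associative lmul.
Proof.
move=> p q r; move: p; apply: laurent_ind => [||i].
- exact: lmul_linl.
- by move=> a u v; rewrite !lmul_linl.
move: q; apply: laurent_ind => [||j].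
- by move=> a u v; rewrite lmul_linl lmul_linr.
- by move=> a u v; rewrite lmul_linr lmul_linl.
move: r; apply: laurent_ind => [||k].
- by move=> a u v; rewrite !lmul_linr.
- exact: lmul_linr.
by rewrite !lmul_mon addrA.
Qed.

Lemma lmul1 : left_id (lmon 0) lmul.
Proof.
apply: laurent_ind => [||k]; [exact: lmul_linr|by []|].
by rewrite lmul_mon add0r.
Qed.

Lemma lmulDl : left_distributive lmul +%R.
Proof. by move=> p q r; have := lmul_linl r 1 p q; rewrite !scale1r. Qed.

Lemma laurent_one_neq0 : lmon 0 != 0.
Proof. by rewrite /lmon monalgU_eq0 oner_eq0. Qed.

HB.instance Definition _ := GRing.Zmodule_isComNzRing.Build (laurent F)
  lmulA lmulC lmul1 lmulDl laurent_one_neq0.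

Lemma laurent_scaleAl (a : F) p q : a *: (p * q) = (a *: p) * q.
Proof.
have := lmul_linl q a p 0.
by rewrite addr0 (mul0r q : lmul 0 q = 0) addr0 => <-.
Qed.

HB.instance Definition _ :=
  GRing.Lmodule_isLalgebra.Build F (laurent F) laurent_scaleAl.
HB.instance Definition _ := GRing.Lalgebra_isComAlgebra.Build F (laurent F).

Definition tpos : laurent F := lmon 1.
Definition tneg : laurent F := lmon (- 1).

Lemma lmonD i j : lmon (i + j) = lmon i * lmon j.
Proof. by rewrite -[RHS]/(lmul _ _) lmul_mon. Qed.

Lemma tposK : tpos * tneg = 1.
Proof. by rewrite -lmonD. Qed.

(* p(t) |-> p(t^-1) *)
Definition linv : laurent F -> laurent F := lext (fun k => lmon (- k)).

HB.instance Definition _ := GRing.Linear.copy linv (lext (fun k => lmon (- k))).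

Lemma linv_mon k : linv (lmon k) = lmon (- k).
Proof. exact: lext_mon. Qed.

Lemma linv_is_monoid_morphism : monoid_morphism linv.
Proof.
split=> [|p q]; first by rewrite linv_mon oppr0.
move: p; apply: laurent_ind => [||i].
- by move=> a u v; rewrite mulrDl -scalerAl linearP.
- by move=> a u v; rewrite linearP mulrDl -scalerAl.
move: q; apply: laurent_ind => [||j].
- by move=> a u v; rewrite mulrDr -scalerAr linearP.
- by move=> a u v; rewrite linearP mulrDr -scalerAr.
by rewrite -lmonD !linv_mon -lmonD opprD.
Qed.

HB.instance Definition _ :=
  GRing.isMonoidMorphism.Build (laurent F) (laurent F) linv
    linv_is_monoid_morphism.

(* p(t) |-> p(1) *)
Definition leval1 : laurent F -> F^o := lext (fun _ => 1 : F^o).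

HB.instance Definition _ := GRing.Linear.copy leval1 (lext (fun _ => 1 : F^o)).

Lemma leval1_mon k : leval1 (lmon k) = 1.
Proof. exact: lext_mon. Qed.

Lemma leval1_is_monoid_morphism : monoid_morphism leval1.
Proof.
split=> [|p q]; first by rewrite leval1_mon.
move: p; apply: laurent_ind => [||i].
- by move=> a u v; rewrite mulrDl -scalerAl linearP.
- by move=> a u v; rewrite linearP mulrDl -scalerAl.
move: q; apply: laurent_ind => [||j].
- by move=> a u v; rewrite mulrDr -scalerAr linearP.
- by move=> a u v; rewrite linearP mulrDr -scalerAr.
by rewrite -lmonD !leval1_mon mulr1.
Qed.

HB.instance Definition _ :=
  GRing.isMonoidMorphism.Build (laurent F) F^o leval1
    leval1_is_monoid_morphism.

End Laurent.

Arguments lmon {F}.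
Arguments tpos {F}.
Arguments tneg {F}.

Definition mx2 (A : Type) (a b c d : A) : 'M[A]_2 :=
  \matrix_(i < 2, j < 2)
    if i == 0 then (if j == 0 then a else b) else (if j == 0 then c else d).

Lemma commutator_jacobi (A : nzRingType) (x y z : A) :
  (x * (y * z - z * y) - (y * z - z * y) * x)
  + (y * (z * x - x * z) - (z * x - x * z) * y)
  + (z * (x * y - y * x) - (x * y - y * x) * z) = 0.
Proof.
rewrite !mulrBr !mulrBl !mulrA !opprB.
rewrite (AC ((2*2)*(2*2)*(2*2)) ((1*12)*(7*2)*(3*10)*(5*4)*(11*6)*(9*8))) /=.
by rewrite !subrr !addr0.
Qed.

(* An alias, because 'M[laurent F]_2 is already a module over laurent F;
   as a Lie algebra over F it needs scalars in F. *)
Definition loop_gl2 (F : fieldType) : Type := 'M[laurent F]_2.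

HB.instance Definition _ (F : fieldType) := GRing.Zmodule.on (loop_gl2 F).

Section LoopGl2.
Variable F : fieldType.
Implicit Types x y z : loop_gl2 F.

Definition loop_scale (a : F) x : loop_gl2 F := map_mx (fun p => a *: p) x.

Lemma loop_scaleA a b x : loop_scale a (loop_scale b x) = loop_scale (a * b) x.
Proof. by apply/matrixP => i j; rewrite !mxE scalerA. Qed.
Lemma loop_scale1 : left_id 1 loop_scale.
Proof. by move=> x; apply/matrixP => i j; rewrite !mxE scale1r. Qed.
Lemma loop_scaleDr : right_distributive loop_scale +%R.
Proof. by move=> a x y; apply/matrixP => i j; rewrite !mxE scalerDr. Qed.
Lemma loop_scaleDl x : {morph loop_scale^~ x : a b / a + b}.
Proof. by move=> a b; apply/matrixP => i j; rewrite !mxE scalerDl. Qed.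

HB.instance Definition _ := GRing.Zmodule_isLmodule.Build F (loop_gl2 F)
  loop_scaleA loop_scale1 loop_scaleDr loop_scaleDl.

Lemma loop_scaleE (a : F) x i j : (a *: x) i j = a *: x i j.
Proof. by rewrite mxE. Qed.

Definition loop_lie x y : loop_gl2 F := x *m y - y *m x.

Lemma loop_lieDl x y z : loop_lie (x + y) z = loop_lie x z + loop_lie y z.
Proof. by rewrite /loop_lie mulmxDl mulmxDr opprD addrACA. Qed.

Lemma loop_lieC x y : loop_lie x y = - loop_lie y x.
Proof. by rewrite /loop_lie opprB. Qed.

Lemma loop_lieDr x y z : loop_lie x (y + z) = loop_lie x y + loop_lie x z.
Proof. by rewrite /loop_lie mulmxDr mulmxDl opprD addrACA. Qed.

Lemma loop_scale_alg (a : F) x :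
  a *: x = (a%:A : laurent F) *: (x : 'M[laurent F]_2).
Proof. by apply/matrixP => i j; rewrite !mxE mulr_algl. Qed.

Lemma loop_lieZl (a : F) x y : loop_lie (a *: x) y = a *: loop_lie x y.
Proof. by rewrite /loop_lie !loop_scale_alg -scalemxAl -scalemxAr -scalerBr. Qed.

Lemma loop_lieZr (a : F) x y : loop_lie x (a *: y) = a *: loop_lie x y.
Proof. by rewrite loop_lieC loop_lieZl -scalerN -loop_lieC. Qed.

Lemma loop_liexx x : loop_lie x x = 0.
Proof. by rewrite /loop_lie subrr. Qed.

Lemma loop_jacobi x y z :
  loop_lie x (loop_lie y z) + loop_lie y (loop_lie z x)
  + loop_lie z (loop_lie x y) = 0.
Proof. exact: (commutator_jacobi (x : 'M[laurent F]_2) y z). Qed.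

HB.instance Definition _ := Lmodule_isLieAlgebra.Build F (loop_gl2 F)
  loop_lieDl loop_lieDr loop_lieZl loop_lieZr loop_liexx loop_jacobi.

Definition theta x : loop_gl2 F :=
  mx2 (linv (x 1 1)) (linv (x 1 0))
      (linv (x 0 1)) (linv (x 0 0)).

Definition eps x : F := leval1 (x 0 0) + leval1 (x 1 1).

Lemma thetaE x i j : theta x i j = linv (x (rev_ord i) (rev_ord j)).
Proof.
rewrite !mxE; case: i => [[|[|//]] Hi]; case: j => [[|[|//]] Hj] /=;
  by congr (linv (x _ _)); apply: val_inj.
Qed.

Lemma theta_is_linear : linear theta.
Proof.
move=> a x y; apply/matrixP => i j.
by rewrite [RHS]mxE loop_scaleE !thetaE mxE loop_scaleE linearP.
Qed.

HB.instance Definition _ :=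
  GRing.isLinear.Build F (loop_gl2 F) (loop_gl2 F) _ theta theta_is_linear.

Lemma theta_mul x y : theta (x *m y) = theta x *m theta y.
Proof.
apply/matrixP => i j; rewrite thetaE !mxE rmorph_sum (reindex_inj rev_ord_inj).
by apply: eq_bigr => k _; rewrite !thetaE rmorphM.
Qed.

Lemma theta_lie x y : theta (lie x y) = lie (theta x) (theta y).
Proof. by rewrite /lie /= /loop_lie -!theta_mul -linearB. Qed.

Lemma thetaK : involutive theta.
Proof.
move=> x; apply/matrixP => i j; rewrite !thetaE !rev_ordK.
move: (x i j); apply: laurent_ind => [a p q|//|k]; first by rewrite !linearP.
by rewrite !linv_mon opprK.
Qed.

Lemma eps_is_linear : linear (eps : loop_gl2 F -> F^o).
Proof. move=> a x y; have E i j : (a *: x + y) i j = a *: x i j + y i j.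
  by rewrite mxE loop_scaleE.
rewrite /eps !E !linearP.
by rewrite scalerDr addrACA. Qed.

HB.instance Definition _ :=
  GRing.isLinear.Build F (loop_gl2 F) F^o _ (eps : loop_gl2 F -> F^o)
    eps_is_linear.

Lemma epsE x : eps x = leval1 (\tr (x : 'M[laurent F]_2)).
Proof.
rewrite /eps /mxtrace !big_ord_recl big_ord0 addr0 linearD /=.
by congr (_ + leval1 (x _ _)); apply: val_inj.
Qed.

Lemma eps_lie x y : eps (lie x y) = 0.
Proof.
rewrite epsE /lie /= /loop_lie.
have -> : \tr (x *m y - y *m x) = 0 by rewrite linearB /= mxtrace_mulC subrr.
exact: linear0.
Qed.

Definition ker_eps : {pred loop_gl2 F} := [pred x | eps x == 0].
Definition onsager_pred : {pred loop_gl2 F} :=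
  [pred x | (x \in ker_eps) && (theta x == x)].

Lemma onsager_predP x :
  reflect (eps x = 0 /\ theta x = x) (x \in onsager_pred).
Proof.
by apply: (iffP andP) => [[/eqP ? /eqP ?]|[? ?]]; split=> //; apply/eqP.
Qed.

Lemma onsager_submod_closed : submod_closed onsager_pred.
Proof.
split=> [|a x y /onsager_predP[ex tx] /onsager_predP[ey ty]].
  by apply/onsager_predP; rewrite !linear0.
apply/onsager_predP; split; last by rewrite [LHS]theta_is_linear tx ty.
by rewrite [LHS]eps_is_linear ex ey scaler0 addr0.
Qed.

HB.instance Definition _ :=
  GRing.isSubmodClosed.Build F (loop_gl2 F) onsager_pred onsager_submod_closed.

Lemma onsager_lie_closed x y :
  x \in onsager_pred -> y \in onsager_pred -> lie x y \in onsager_pred.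
Proof.
move=> /onsager_predP[_ tx] /onsager_predP[_ ty].
by apply/onsager_predP; rewrite eps_lie theta_lie tx ty.
Qed.

End LoopGl2.

Arguments ker_eps : clear implicits.
Arguments onsager_pred : clear implicits.

Record onsager (F : fieldType) : Type :=
  Onsager { onsager_val : loop_gl2 F; _ : onsager_val \in onsager_pred F }.

HB.instance Definition _ (F : fieldType) := [isSub for @onsager_val F].
HB.instance Definition _ (F : fieldType) := [Choice of onsager F by <:].
HB.instance Definition _ (F : fieldType) :=
  [SubChoice_isSubLmodule of onsager F by <:].

Section Onsager.
Variable F : fieldType.
Implicit Types x y z : onsager F.

Definition onsager_lie x y : onsager F :=
  Onsager (onsager_lie_closed (valP x) (valP y)).

Lemma onsager_lieDl x y z :
  onsager_lie (x + y) z = onsager_lie x z + onsager_lie y z.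
Proof. by apply: val_inj; rewrite /= lieDl. Qed.
Lemma onsager_lieDr x y z :
  onsager_lie x (y + z) = onsager_lie x y + onsager_lie x z.
Proof. by apply: val_inj; rewrite /= lieDr. Qed.
Lemma onsager_lieZl (a : F) x y :
  onsager_lie (a *: x) y = a *: onsager_lie x y.
Proof. by apply: val_inj; rewrite /= lieZl. Qed.
Lemma onsager_lieZr (a : F) x y :
  onsager_lie x (a *: y) = a *: onsager_lie x y.
Proof. by apply: val_inj; rewrite /= lieZr. Qed.
Lemma onsager_liexx x : onsager_lie x x = 0.
Proof. by apply: val_inj; rewrite /= liexx. Qed.
Lemma onsager_jacobi x y z :
  onsager_lie x (onsager_lie y z) + onsager_lie y (onsager_lie z x)
  + onsager_lie z (onsager_lie x y) = 0.
Proof. by apply: val_inj; rewrite /= lie_jacobi. Qed.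

HB.instance Definition _ := Lmodule_isLieAlgebra.Build F (onsager F)
  onsager_lieDl onsager_lieDr onsager_lieZl onsager_lieZr onsager_liexx
  onsager_jacobi.

Definition W0_mx : loop_gl2 F := mx2 0 1
                                     1 0.
Definition W1_mx : loop_gl2 F := mx2 0    tpos
                                     tneg 0.
Definition G_mx (k : nat) : loop_gl2 F :=
  ((2^-1 : F) *: (tpos + tneg)) ^+ k *:
    (mx2 (2 * tpos - 2) 0
         0              (2 * tneg - 2) : 'M[laurent F]_2).

Lemma theta_mx2 (a b c d : laurent F) :
  theta (mx2 a b c d) = mx2 (linv d) (linv c) (linv b) (linv a).
Proof. by rewrite /theta !mxE. Qed.

Lemma scale_mx2 (p a b c d : laurent F) :
  p *: mx2 a b c d = mx2 (p * a) (p * b) (p * c) (p * d).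
Proof. by apply/matrixP => i j; rewrite !mxE; do 2!case: ifP => _. Qed.

Lemma linv_tpos : linv (tpos : laurent F) = tneg.
Proof. exact: linv_mon. Qed.
Lemma linv_tneg : linv (tneg : laurent F) = tpos.
Proof. by rewrite linv_mon opprK. Qed.

Lemma W0_in : W0_mx \in onsager_pred F.
Proof.
apply/onsager_predP; rewrite theta_mx2 linear0 rmorph1; split=> //.
by rewrite /eps !mxE linear0 addr0.
Qed.

Lemma W1_in : W1_mx \in onsager_pred F.
Proof.
apply/onsager_predP; rewrite theta_mx2 linear0 linv_tpos linv_tneg; split=> //.
by rewrite /eps !mxE linear0 addr0.
Qed.

Lemma leval1_2B2 (p : laurent F) : leval1 p = 1 -> leval1 (2 * p - 2) = 0.
Proof. by move=> p1; rewrite rmorphB rmorphM /= p1 mulr1 subrr. Qed.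

Lemma linv_2B2 (p : laurent F) : linv (2 * p - 2) = 2 * linv p - 2.
Proof. by rewrite rmorphB rmorphM rmorph_nat. Qed.

Lemma linv_half k (a : F) :
  linv ((a *: (tpos + tneg : laurent F)) ^+ k) = (a *: (tpos + tneg)) ^+ k.
Proof. by rewrite rmorphXn /= linearZ /= linearD /= linv_tpos linv_tneg addrC. Qed.

Lemma diag_in (q a d : laurent F) : linv q = q -> linv a = d -> linv d = a ->
    leval1 a = 0 -> leval1 d = 0 ->
  (q *: (mx2 a 0 0 d : 'M[laurent F]_2) : loop_gl2 F) \in onsager_pred F.
Proof.
move=> qE aE dE a0 d0; apply/onsager_predP; rewrite scale_mx2 theta_mx2.
rewrite !mulr0 linear0 (rmorphM _ q d) (rmorphM _ q a) /= qE aE dE; split=> //.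
by rewrite /eps !mxE /= (rmorphM _ q a) (rmorphM _ q d) /= a0 d0 !mulr0 addr0.
Qed.

Lemma G_in k : G_mx k \in onsager_pred F.
Proof.
apply: diag_in; first exact: linv_half.
- by rewrite linv_2B2 linv_tpos.
- by rewrite linv_2B2 linv_tneg.
- exact/leval1_2B2/leval1_mon.
- exact/leval1_2B2/leval1_mon.
Qed.

(* OG k is the element written G_{k+1}. *)
Definition OW0 : onsager F := Onsager W0_in.
Definition OW1 : onsager F := Onsager W1_in.
Definition OG k : onsager F := Onsager (G_in k).

End Onsager.

(* gG k stands for the generator written G_{k+1}, so that the generators are
   W_0, W_1, G_1, G_2, ... *)
Inductive onsager_gen : Type := gW0 | gW1 | gG of nat.

Definition onsager_elt (F : fieldType) (g : onsager_gen) : onsager F :=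
  match g with
  | gW0 => OW0 F
  | gW1 => OW1 F
  | gG k => OG F k
  end.

Section Relations.
Variable F : fieldType.

Local Notation term := (lie_term F onsager_gen).
Local Notation "{[ x , y ]}" := (LBr x y) (format "{[ x ,  y ]}").
Local Notation W0 := (LGen gW0 : term).
Local Notation W1 := (LGen gW1 : term).
Local Notation G k := (LGen (gG k) : term).

(* Because of the shift in gG, the indices k in {1, 2, ...} of the source
   become k.+1 with k : nat; thus G k and G k.+1 are G_{k+1} and G_{k+2}. *)
Inductive onsager_rel : term -> term -> Prop :=
| rel_W0W0W0W1 :
    onsager_rel {[W0, {[W0, {[W0, W1]}]}]} (LScale 4 {[W0, W1]})
| rel_W1W1W1W0 :
    onsager_rel {[W1, {[W1, {[W1, W0]}]}]} (LScale 4 {[W1, W0]})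
| rel_W1W1W0 :
    onsager_rel {[W1, {[W1, W0]}]} {[W1, G 0]}
| rel_W1W0W0 :
    onsager_rel {[{[W1, W0]}, W0]} {[G 0, W0]}
| rel_W1W1W0G k :
    onsager_rel {[W1, {[W1, {[W0, G k]}]}]} (LScale 4 {[W1, G k.+1]})
| rel_GW1W0W0 k :
    onsager_rel {[{[{[G k, W1]}, W0]}, W0]} (LScale 4 {[G k.+1, W0]})
| rel_GG k l :
    onsager_rel {[G k, G l]} LZero.

End Relations.

(* Main.v *)
Require Import Defs.
From HB Require Import structures.
From mathcomp Require Import all_boot all_algebra ring.

Set Implicit Arguments.
Unset Strict Implicit.
Unset Printing Implicit Defensive.

Import GRing.Theory.

Local Open Scope ring_scope.

(** Write an element of the fixed subalgebra as a matrix with first row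
    (a, b) and second row (b^*, a^* ), where f^*(t) = f(1/t) and a(1) = 0.
    Splitting a into its antisymmetric and symmetric parts exhibits the
    algebra as the Onsager algebra, with basis the off-diagonal matrices A_n
    (b = t^n, n an integer) and the diagonal ones B_n (a = t^n - t^-n, n > 0),
    plus a centre, made of the symmetric a.  Put c = (t + 1/t)/2.  The centre
    has basis (2c - 2) c^k, which is the symmetric part of G_{k+1}, whereas the
    antisymmetric part of G_{k+1} is (t - 1/t) c^k.

    In the presented algebra, W_0 and W_1 satisfy the Dolan-Grady relations.
    Let B = [W_1, W_0], and define A_n for all integers n by A_0 = W_0,
    A_1 = W_1 and [B, A_n] = 2 (A_{n+1} - A_{n-1}).  Every consecutive pair
    again satisfies the Dolan-Grady relations, with the same B
    (dolan_grady_step): passing from A_{n-1} to A_{n+1} is the reflection that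
    changes the sign of the part of A_{n-1} on which ad A_n acts with
    eigenvalues 2 and -2.  From [A_{n+1}, A_n] = B for all n an induction on
    m - n gives all the relations of the Onsager algebra: [A_m, A_n] = B_{m-n}
    depends on m - n only, [B_m, A_n] = 2 (A_{n+m} - A_{n-m}), and
    [B_m, B_n] = 0 (levelP, ladder_lieAA, ladder_lieBA, ladder_lieBB).

    Let H_k be the combination of the B_n that corresponds to (t - 1/t) c^k.
    The relations between the G_{k+1} and W_0, W_1 say, by induction on k, that
    Z_k = G_{k+1} - H_k commutes with W_0 and W_1 (symG_commutes_gens), hence
    with all A_n and B_n; since the G's commute with each other, so do the Z's.
    Thus the A_n, B_n and Z_k span the presented algebra
    (presented_normal_form).  Their images are the basis described above, so
    the canonical map is injective (onsager_normal_form_eq0).  It is surjective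
    because a symmetric Laurent polynomial is a polynomial in c, by means of
    the Chebyshev polynomials, and is divisible by c - 1 if it vanishes at
    t = 1 (onsager_coordinatesK). *)

(** * Linear combinations *)

(** Formal linear combinations of numbered vectors: to prove an identity between
    linear combinations in a module, it suffices to compare the coefficients of
    each vector.  The tactic combine performs this reduction; the resulting
    identities between scalars are left to ring or field. *)
Inductive comb (F : Type) : Type :=
| CVar of nat
| CZero
| CAdd of comb F & comb F
| COpp of comb F
| CScale of F & comb F.

Arguments CVar {F}.
Arguments CZero {F}.

Section Combinations.
Variables (F : fieldType) (V : lmodType F).
Implicit Types (e : comb F) (env : seq V).

Fixpoint comb_eval env e : V :=
  match e with
  | CVar i => env`_i
  | CZero => 0
  | CAdd e1 e2 => comb_eval env e1 + comb_eval env e2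
  | COpp e1 => - comb_eval env e1
  | CScale a e1 => a *: comb_eval env e1
  end.

Fixpoint comb_coef e (i : nat) : F :=
  match e with
  | CVar j => if i == j then 1 else 0
  | CZero => 0
  | CAdd e1 e2 => comb_coef e1 i + comb_coef e2 i
  | COpp e1 => - comb_coef e1 i
  | CScale a e1 => a * comb_coef e1 i
  end.

Fixpoint same_coefs e1 e2 (n : nat) : Prop :=
  if n is m.+1 then comb_coef e1 m = comb_coef e2 m /\ same_coefs e1 e2 m
  else True.

Lemma comb_evalE env e :
  comb_eval env e = \sum_(i < size env) comb_coef e i *: env`_i.
Proof.
elim: e => [j||e1 IH1 e2 IH2|e1 IH1|a e1 IH1] /=.
- have [jn|nj] := ltnP j (size env).
    rewrite (bigD1 (Ordinal jn)) //= eqxx scale1r big1 ?addr0 // => i.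
    by rewrite -val_eqE /= => /negPf->; rewrite scale0r.
  rewrite nth_default // big1 // => i _; rewrite ltn_eqF ?scale0r //.
  exact: leq_trans (ltn_ord i) nj.
- by rewrite big1 // => i _; rewrite scale0r.
- by rewrite IH1 IH2 -big_split; apply: eq_bigr => i _; rewrite scalerDl.
- by rewrite IH1 -sumrN; apply: eq_bigr => i _; rewrite scaleNr.
- by rewrite IH1 scaler_sumr; apply: eq_bigr => i _; rewrite scalerA.
Qed.

Lemma comb_eq env e1 e2 :
  same_coefs e1 e2 (size env) -> comb_eval env e1 = comb_eval env e2.
Proof.
rewrite !comb_evalE; elim: (size env) => [|n IH] /=; first by rewrite !big_ord0.
by case=> eqn eqs; rewrite !big_ord_recr /= IH // eqn.
Qed.

End Combinations.

(** Atoms are compared up to conversion, because the same vector may occur with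
    syntactically different algebraic structures.  The nested matches on Set
    run unify while a term is being computed, with backtracking if it fails. *)
Ltac comb_mem x env :=
  match env with
  | nil => constr:(false)
  | ?y :: ?t => match constr:(Set) with
                | _ => let _ := match constr:(Set) with _ => unify x y end in
                       constr:(true)
                | _ => comb_mem x t
                end
  end.

Ltac comb_atoms t env :=
  match t with
  | 0 => env
  | ?u + ?v => let env1 := comb_atoms u env in comb_atoms v env1
  | - ?u => comb_atoms u env
  | _ *: ?u => comb_atoms u env
  | _ => match comb_mem t env with
         | true => env
         | false => constr:(t :: env)
         end
  end.

Ltac comb_index x env :=
  match env with
  | ?y :: ?t => match constr:(Set) with
                | _ => let _ := match constr:(Set) with _ => unify x y end in
                       constr:(0%N)
                | _ => let n := comb_index x t in constr:(S n)
                end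
  end.

Ltac comb_reify F t env :=
  match t with
  | 0 => constr:(@CZero F)
  | ?u + ?v => let e1 := comb_reify F u env in
               let e2 := comb_reify F v env in constr:(@CAdd F e1 e2)
  | - ?u => let e := comb_reify F u env in constr:(@COpp F e)
  | ?a *: ?u => let e := comb_reify F u env in constr:(@CScale F a e)
  | _ => let i := comb_index t env in constr:(@CVar F i)
  end.

Ltac combine F :=
  match goal with
  | |- @eq ?V ?t ?u =>
    let env0 := comb_atoms t (@nil V) in
    let env := comb_atoms u env0 in
    let e1 := comb_reify F t env in
    let e2 := comb_reify F u env in
    apply: (@comb_eq F _ env e1 e2); rewrite /=; repeat split
  end.

(** * Linear maps out of polynomial spaces *)

Lemma laurent_bilinear_ext (F : fieldType) (V : lmodType F)
    (f g : laurent F -> laurent F -> V) :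
    (forall q, linear (f^~ q)) -> (forall q, linear (g^~ q)) ->
    (forall p, linear (f p)) -> (forall p, linear (g p)) ->
    (forall i j, f (lmon i) (lmon j) = g (lmon i) (lmon j)) ->
  forall p q, f p q = g p q.
Proof.
move=> fl gl fr gr fg p q; move: p; apply: laurent_ind => // i; move: q.
by apply: laurent_ind => // j; exact: fg.
Qed.

Section PolynomialExtension.
Variables (F : fieldType) (V : lmodType F).
Implicit Types (h : nat -> V) (p : {poly F}).

Definition pext h p : V := \sum_(k < size p) p`_k *: h k.

Lemma pext_widen h p n :
  (size p <= n)%N -> pext h p = \sum_(k < n) p`_k *: h k.
Proof.
move=> le_pn; rewrite /pext (big_ord_widen _ (fun k => p`_k *: h k) le_pn).
rewrite big_mkcond; apply: eq_bigr => k _; case: ltnP => // /leq_sizeP->//.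
by rewrite scale0r.
Qed.

Fact pext_is_linear h : linear (pext h).
Proof.
move=> a p q; set n := maxn (size p) (size q).
have le_n : (size (a *: p + q)%R <= n)%N.
  apply: leq_trans (size_polyD _ _) _; rewrite geq_max leq_maxr andbT.
  by rewrite (leq_trans (size_scale_leq _ _)) ?leq_maxl.
rewrite (pext_widen _ le_n) (pext_widen _ (leq_maxl _ _ : _ <= n)%N).
rewrite (pext_widen _ (leq_maxr _ _ : _ <= n)%N) scaler_sumr -big_split /=.
by apply: eq_bigr => k _; rewrite coefD coefZ scalerDl scalerA.
Qed.

HB.instance Definition _ h :=
  GRing.isLinear.Build F {poly F} V _ (pext h) (pext_is_linear h).

Lemma pext_Xn h k : pext h 'X^k = h k.
Proof.
rewrite /pext size_polyXn big_ord_recr /= coefXn eqxx scale1r big1 ?add0r //.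
by move=> i _; rewrite coefXn ltn_eqF ?scale0r.
Qed.

End PolynomialExtension.

Lemma linear_lext (F : fieldType) (V W : lmodType F) (f : {linear V -> W})
    (h : int -> V) (h' : int -> W) :
  (forall n, f (h n) = h' n) -> forall p, f (lext h p) = lext h' p.
Proof.
move=> fh p; rewrite !lextE linear_sum.
by apply: eq_bigr => k _; rewrite linearZ /= fh.
Qed.

Lemma linear_pext (F : fieldType) (V W : lmodType F) (f : {linear V -> W})
    (h : nat -> V) (h' : nat -> W) :
  (forall n, f (h n) = h' n) -> forall p, f (pext h p) = pext h' p.
Proof.
move=> fh p; rewrite /pext linear_sum.
by apply: eq_bigr => k _; rewrite linearZ /= fh.
Qed.

Lemma poly_linear_ext (F : fieldType) (V : lmodType F) (f g : {poly F} -> V) :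
  linear f -> linear g -> (forall k, f 'X^k = g 'X^k) -> f =1 g.
Proof.
move=> fl gl fg p.
pose fL : {linear {poly F} -> V} :=
  HB.pack f (GRing.isLinear.Build F {poly F} V _ f fl).
pose gL : {linear {poly F} -> V} :=
  HB.pack g (GRing.isLinear.Build F {poly F} V _ g gl).
rewrite -[f]/(fL : _ -> _) -[g]/(gL : _ -> _) -[p]coefK poly_def !linear_sum.
by apply: eq_bigr => k _; rewrite !linearZ /= fg.
Qed.

(** * Lie algebras *)

Section LieAlgebra.
Variables (F : fieldType) (L : lieAlgType F).
Implicit Types (x y z : L) (a : F).

Fact lie_is_linear x : linear (lie x).
Proof. by move=> a y z; rewrite lieDr lieZr. Qed.

HB.instance Definition _ x :=
  GRing.isLinear.Build F L L _ (lie x) (lie_is_linear x).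

Lemma lieC x y : lie x y = - lie y x.
Proof.
apply/eqP; rewrite -addr_eq0; have := liexx (x + y).
by rewrite lieDl !lieDr !liexx add0r addr0 => ->.
Qed.

Lemma lie0l x : lie 0 x = 0.
Proof. by rewrite lieC linear0 oppr0. Qed.

Lemma lie0r x : lie x 0 = 0.
Proof. exact: linear0. Qed.

Lemma lieNl x y : lie (- x) y = - lie x y.
Proof. by rewrite lieC [X in - X]linearN [lie x y]lieC. Qed.

Lemma lieBl x y z : lie (x - y) z = lie x z - lie y z.
Proof. by rewrite lieDl lieNl. Qed.

Lemma lieNr x y : lie x (- y) = - lie x y.
Proof. exact: linearN. Qed.

Lemma lieBr x y z : lie x (y - z) = lie x y - lie x z.
Proof. exact: linearB. Qed.

Lemma lie_leibniz x y z :
  lie x (lie y z) = lie (lie x y) z + lie y (lie x z).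
Proof.
apply: subr0_eq; rewrite -[RHS](lie_jacobi x y z) (lieC x z) linearN.
rewrite (lieC (lie x y)) /=; combine F; ring.
Qed.

Lemma lie_commute x y z : lie z x = 0 -> lie z y = 0 -> lie z (lie x y) = 0.
Proof. by move=> zx zy; rewrite lie_leibniz zx zy lie0l linear0 addr0. Qed.

End LieAlgebra.

(** * The Dolan-Grady relations propagate *)

Lemma int_step_ind (P : int -> Prop) :
  P 0 -> (forall n, P n -> P (n + 1)) -> (forall n, P (n + 1) -> P n) ->
  forall n, P n.
Proof.
move=> P0 Pup Pdown; elim/int_ind => [//|n /Pup|n Pn].
  by rewrite intS addrC.
by apply: Pdown; rewrite intS (_ : - (1 + n%:Z) + 1 = - n%:Z) //; ring.
Qed.

(** Induction for sequences indexed by all integers that satisfy a two-term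
    recurrence solvable in both directions. *)
Lemma int_pair_ind (P : int -> Prop) :
    P 0 -> P 1 -> (forall n, P (n - 1) -> P n -> P (n + 1)) ->
    (forall n, P n -> P (n + 1) -> P (n - 1)) ->
  forall n, P n.
Proof.
move=> P0 P1 Pup Pdown n.
suff [] : P n /\ P (n + 1) by [].
elim/int_step_ind: n => [//|n [Pn Pn1]|n [Pn1 Pn2]]; split => //.
  by apply: Pup => //; rewrite addrK.
by rewrite -(addrK 1 n); apply: Pdown.
Qed.

Section CharZero.
Variables (F : fieldType) (charF0 : [pchar F] =i pred0).

Lemma natr_neq0 n : n.+1%:R != 0 :> F.
Proof. by have /pcharf0P -> := charF0. Qed.

Lemma scaler_nat_eq0 (V : lmodType F) n (v : V) : n.+1%:R *: v = 0 -> v = 0.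
Proof. by move/eqP; rewrite scaler_eq0 (negPf (natr_neq0 n)) => /eqP. Qed.

Variable L : lieAlgType F.

Let lieE :=
  (@lieDl F L, @lieDr F L, @lieNl F L, @lieNr F L, @lieZl F L, @lieZr F L).

(** Here x is killed by ad y, and s lies in the sum of the eigenspaces of ad y
    for 2 and -2, so that the reflection x + s |-> x - s is the action of
    (-1)^(ad y / 2).  That operator need not exist on L, but the conclusion
    only needs the terms of odd degree in s to separate from those of even
    degree in the hypothesis: the former, q - 4 b, lie in the eigenspace of
    (ad y)^2 for 4, the latter, e, in the sum of those for 0 and 16; hence
    e = 0. *)
Lemma dolan_grady_reflect (x s b y : L) :
    lie y x = 0 -> lie y s = b -> lie y b = 4 *: s ->
    lie (x + s) (lie (x + s) b) = 4 *: b ->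
  lie (x - s) (lie (x - s) b) = 4 *: b.
Proof.
move=> yx ys yb.
pose q := lie x (lie x b) + lie s (lie s b).
pose e := lie x (lie s b) + lie s (lie x b).
pose v := lie s (lie x b) + lie b (lie x s).
have -> : lie (x + s) (lie (x + s) b) = q + e.
  by rewrite /q /e !lieE; combine F; ring.
have -> : lie (x - s) (lie (x - s) b) = q - e.
  by rewrite /q /e !lieE; combine F; ring.
have yxu u : lie y (lie x u) = lie x (lie y u).
  by rewrite lie_leibniz yx lie0l add0r.
have ysu u : lie y (lie s u) = lie b u + lie s (lie y u).
  by rewrite lie_leibniz ys.
have ybu u : lie y (lie b u) = 4 *: lie s u + lie b (lie y u).
  by rewrite lie_leibniz yb lieZl.
pose yE :=
  (yxu, ysu, ybu, yx, ys, yb, lieE, @liexx F L, @lie0l F L, @lie0r F L).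
have Tq : lie y (lie y q) = 4 *: q.
  by rewrite /q !yE; combine F; ring.
have Te : lie y (lie y e) = 8 *: v.
  by rewrite /e /v !yE (lieC b s) lieNr; combine F; ring.
have Tv : lie y (lie y v) = 16 *: v.
  by rewrite /v !yE; combine F; ring.
clearbody q e v; move=> qe; have := congr1 (fun u => lie y (lie y u)) qe.
rewrite /= !lieE Tq Te yb lieZr ys -qe => qv.
(* Here (ad y)^2 has been applied to q + e = 4 b. *)
have e2v : e = 2 *: v.
  apply: (scalerI (natr_neq0 3)); rewrite -[LHS](addKr (4 *: q)) -scalerDr -qv.
  by combine F; ring.
(* Applying (ad y)^2 to e = 2 v gives 8 v = 32 v. *)
have v0 : v = 0.
  apply: (@scaler_nat_eq0 _ 23); have := congr1 (fun u => lie y (lie y u)) e2v.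
  rewrite /= !lieE Te Tv => /eqP; rewrite -subr_eq0 => /eqP vv.
  by rewrite -[LHS]opprK -[in RHS]oppr0 -vv; combine F; ring.
by rewrite e2v v0 scaler0 addr0 subr0.
Qed.

(** The pair (x, y) of Dolan-Grady generators can be replaced by (y, z),
    with the same b.  The part of x in the eigenspaces of ad y for 2 and -2 is
    s = (1/4) [y, b], and z = x - 2 s is the reflection of x. *)
Lemma dolan_grady_step (x y : L) (b := lie y x) (z := x + 2^-1 *: lie b y) :
    lie x (lie x b) = 4 *: b -> lie y (lie y b) = 4 *: b ->
  lie z y = b /\ lie z (lie z b) = 4 *: b.
Proof.
move=> xxb yyb; have n4 := natr_neq0 3; have n2 := natr_neq0 1.
pose s := 4^-1 *: lie y b.
have yb : lie y b = 4 *: s by rewrite scalerA divff ?scale1r.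
have ys : lie y s = b by rewrite lieZr yyb scalerA mulVf ?scale1r.
have -> : z = (x - s) - s.
  rewrite /z /s (lieC b); combine F; field; exact/andP.
split.
  rewrite lieC !lieBr ys -/b; combine F; ring.
apply: (dolan_grady_reflect (y := y)) => //; last by rewrite subrK.
by rewrite lieBr ys subrr.
Qed.

Definition ladder (b : L) (A : int -> L) : Prop :=
  forall n, lie b (A n) = 2 *: (A (n + 1) - A (n - 1)).

Lemma ladder_up b A n :
  ladder b A -> A (n + 1) = A (n - 1) + 2^-1 *: lie b (A n).
Proof.
by move=> ->; rewrite scalerA mulVf ?natr_neq0 // scale1r addrCA subrr addr0.
Qed.

Lemma ladder_down b A n :
  ladder b A -> A (n - 1) = A (n + 1) - 2^-1 *: lie b (A n).
Proof. by move=> /ladder_up->; rewrite addrK. Qed.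

Lemma ladder_unique b A A' :
  ladder b A -> ladder b A' -> A 0 = A' 0 -> A 1 = A' 1 -> A =1 A'.
Proof.
move=> bA bA' A0 A1; elim/int_pair_ind => // n An An1.
  by rewrite (ladder_up _ bA) (ladder_up _ bA') An An1.
by rewrite (ladder_down _ bA) (ladder_down _ bA') An An1.
Qed.

(** The ladder is computed from the pair (x, y) of its first two terms by
    moving the pair one step, and in the negative direction from the pair
    (y, x), which changes the sign of [y, x]; the term of index - (m + 1) is
    number m + 2 in that direction, as the numbering starts with y. *)
Fixpoint half_ladder (b x y : L) (n : nat) : L :=
  if n is m.+1 then half_ladder b y (x + 2^-1 *: lie b y) m else x.

Lemma half_ladderSS b x y n :
  half_ladder b x y n.+2
    = half_ladder b x y n + 2^-1 *: lie b (half_ladder b x y n.+1).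
Proof. by elim: n x y => [//|n IH] x y; exact: IH. Qed.

Definition full_ladder (b x y : L) (n : int) : L :=
  match n with
  | Posz m => half_ladder b x y m
  | Negz m => half_ladder (- b) y x m.+2
  end.

Lemma full_ladderP b x y : ladder b (full_ladder b x y).
Proof.
set A := full_ladder b x y.
have step n : A (n + 1) = A (n - 1) + 2^-1 *: lie b (A n).
  case: n => [[|m]|m].
  - by rewrite add0r sub0r /= lieNl scalerN subrK.
  - have -> : Posz m.+1 - 1 = Posz m by rewrite intS addrC addKr.
    have -> : Posz m.+1 + 1 = Posz m.+2 by rewrite [RHS]intS addrC.
    exact: half_ladderSS.
  have -> : Negz m - 1 = Negz m.+1 by rewrite !NegzE [in RHS]intS opprD addrC.
  have -> : A (Negz m + 1) = half_ladder (- b) y x m.+1.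
    case: m => [//|m]; have -> // : Negz m.+1 + 1 = Negz m.
    by rewrite !NegzE [in LHS]intS; ring.
  rewrite [A (Negz m.+1)]half_ladderSS lieNl scalerN subrK //.
move=> n; rewrite step addrAC subrr add0r scalerA mulfV ?scale1r //.
exact: natr_neq0.
Qed.

Lemma ladder_consecutive b A (bA : ladder b A) :
    lie (A 1) (A 0) = b ->
    lie (A 0) (lie (A 0) b) = 4 *: b -> lie (A 1) (lie (A 1) b) = 4 *: b ->
  forall n, lie (A (n + 1)) (A n) = b.
Proof.
move=> b01 dg0 dg1 n.
suff [] : [/\ lie (A (n + 1)) (A n) = b, lie (A n) (lie (A n) b) = 4 *: b
            & lie (A (n + 1)) (lie (A (n + 1)) b) = 4 *: b] by [].
elim/int_step_ind: n => [//|n [bn dgn dgn1]|n [bn dgn1 dgn2]].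
  have := @dolan_grady_step (A n) (A (n + 1)).
  have := ladder_up (n + 1) bA; rewrite addrK => up.
  by rewrite /= bn -up => /(_ dgn dgn1)[].
have := @dolan_grady_step (A (n + 1 + 1)) (A (n + 1)).
have := ladder_down (n + 1) bA; rewrite addrK => down.
rewrite /= (lieC (A (n + 1))) bn lieNl !lieNr !scalerN -down dgn1 dgn2.
move=> -[] // e1 e2; split=> //.
  by rewrite lieC e1 opprK.
by rewrite -[LHS]opprK e2 opprK.
Qed.

(** * The Onsager relations *)

Section OnsagerRelations.
Variables (b : L) (A : int -> L).
Hypothesis bA : ladder b A.
Hypothesis consec : forall n, lie (A (n + 1)) (A n) = b.

(** The statement about the index k that is propagated by induction: the
    bracket of two terms at distance k depends on the distance only, and its
    action on the ladder is the shift by k minus the shift by -k. *)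
Definition level (k : int) : Prop :=
  (forall n, lie (A (n + k)) (A n) = lie (A k) (A 0)) /\
  (forall n, lie (lie (A k) (A 0)) (A n) = 2 *: (A (n + k) - A (n - k))).

Lemma level0 : level 0.
Proof.
split=> n; rewrite ?addr0 ?subr0 ?liexx //.
by rewrite lie0l subrr scaler0.
Qed.

Lemma level1 : level 1.
Proof. by rewrite /level (_ : lie (A 1) (A 0) = b) // -(consec 0) add0r. Qed.

(** Write c1 for the bracket of terms at distance k + 1 and C n for
    [A_{n+k+2}, A_n].  Applying ad b to c1 = [A_{n+k+1}, A_n] shows that
    C n - C (n - 1) is half of [b, c1] for every n.  Computing the same bracket
    [b, c1] as minus the action of c1 on b = [A_1, A_0] gives
    - [b, c1] = 2 (C 0 - C (- k - 1)) = (k + 1) [b, c1].  In characteristic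
    zero [b, c1] vanishes, and C is constant. *)
Lemma level_step (k : nat) : level k -> level (k%:Z + 1) -> level (k%:Z + 2).
Proof.
move=> [shift0 act0] [shift1 act1]; set K := k%:Z in shift0 act0 shift1 act1 *.
set c0 := lie (A K) (A 0) in shift0 act0; set c1 := lie _ _ in shift1 act1.
pose C n := lie (A (n + (K + 2))) (A n).
have sh0 m n : m = n + K -> lie (A m) (A n) = c0 by move=> ->.
have sh1 m n : m = n + (K + 1) -> lie (A m) (A n) = c1 by move=> ->.
have sh2 m n : m = n + (K + 2) -> lie (A m) (A n) = C n by move=> ->.
have diffC n : lie b c1 = 2 *: (C n - C (n - 1)).
  rewrite -(shift1 n) lie_leibniz !bA !(lieZl, lieZr) lieBl lieBr.
  rewrite (sh2 (n + (K + 1) + 1)) ?(sh0 (n + (K + 1) - 1)); try ring.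
  rewrite (sh0 (n + (K + 1)) (n + 1)) ?(sh2 (n + (K + 1)) (n - 1)); try ring.
  by combine F; ring.
have jumpC (j : nat) : 2 *: (C 0 - C (- j%:Z)) = j%:R *: lie b c1.
  elim: j => [|j IH]; first by rewrite oppr0 subrr scaler0 scale0r.
  have -> : - j.+1%:Z = - j%:Z - 1 by rewrite intS; ring.
  rewrite -[j.+1]addn1 natrD [RHS]scalerDl scale1r -IH (diffC (- j%:Z)).
  by combine F; ring.
have anti : - lie b c1 = 2 *: (C 0 - C (- (K + 1))).
  have b01 : b = lie (A 1) (A 0) by rewrite -(consec 0) add0r.
  rewrite -lieC {1}b01 lie_leibniz !act1 !(lieZl, lieZr) lieBl lieBr.
  rewrite (sh2 (1 + (K + 1)) 0); last by ring.
  rewrite (lieC (A (1 - _))) (sh0 0); last by ring.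
  rewrite (lieC (A 1) (A (0 + _))) (sh0 (0 + _)); last by ring.
  rewrite sub0r (sh2 1); last by ring.
  by combine F; ring.
have bc1 : lie b c1 = 0.
  have := jumpC k.+1; have -> : - k.+1%:Z = - (K + 1) by rewrite intS addrC.
  rewrite -anti => e.
  apply: (scaler_nat_eq0 (n := k.+1)).
  rewrite -[k.+2]addn1 natrD scalerDl scale1r.
  by rewrite -e addNr.
have C0 n : C n = C 0.
  have st n' : C n' = C (n' - 1).
    apply/subr0_eq/(scaler_nat_eq0 (n := 1)).
    by rewrite -[2]/(1.+1%:R) -diffC.
  elim/int_step_ind: n => [//|n <-|n <-]; last by rewrite [RHS]st addrK.
  by rewrite st addrK.
have C0E : lie (A (K + 2)) (A 0) = C 0 by rewrite /C add0r.
split=> n; first by rewrite C0E -(C0 n).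
rewrite C0E -(C0 (n - 1)) {1}/C lieC lie_leibniz.
rewrite (lieC (A n) (A (_ + _))) sh1; last by ring.
have nE : lie (A n) (A (n - 1)) = b by rewrite -{1}(subrK 1 n).
rewrite nE lieNl act1 (lieC _ b) bA.
have -> : n - 1 + (K + 2) - 1 = n - 1 + (K + 1) by ring.
have -> : n - 1 + (K + 2) + 1 = n + (K + 2) by ring.
have -> : n - 1 - (K + 1) = n - (K + 2) by ring.
by combine F; ring.
Qed.

Lemma level_nat (k : nat) : level k.
Proof.
suff [] : level k /\ level (k%:Z + 1) by [].
elim: k => [|k [IH0 IH1]]; first by split; [exact: level0|exact: level1].
by rewrite -addn1 PoszD; split=> //; rewrite -addrA; exact: level_step.
Qed.

Lemma levelP k : level k.
Proof.
have [m [->|->]] : exists m : nat, k = m \/ k = - m%:Z.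
  by case: k => m; [exists m; left|exists m.+1; right].
  exact: level_nat.
have [sh act] := level_nat m.
have e n : lie (A (n - m%:Z)) (A n) = - lie (A m) (A 0).
  by rewrite lieC -(sh (n - m%:Z)) subrK.
have e0 : lie (A (- m%:Z)) (A 0) = - lie (A m) (A 0) by rewrite -(e 0) sub0r.
split=> n; rewrite e0; first exact: e.
by rewrite lieNl act opprK; combine F; ring.
Qed.

Lemma ladder_lieAA m n : lie (A m) (A n) = lie (A (m - n)) (A 0).
Proof.
by have [shift _] := levelP (m - n); rewrite -(shift n) addrC subrK.
Qed.

Lemma ladder_lieBA m n :
  lie (lie (A m) (A 0)) (A n) = 2 *: (A (n + m) - A (n - m)).
Proof. by have [_ ->] := levelP m. Qed.

Lemma ladder_lieBB m n : lie (lie (A m) (A 0)) (lie (A n) (A 0)) = 0.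
Proof.
rewrite lie_leibniz !ladder_lieBA !(lieZl, lieZr) lieBl lieBr.
rewrite !add0r !(ladder_lieAA n) opprK.
by combine F; ring.
Qed.

End OnsagerRelations.

Section LadderSpan.
Variables (b : L) (A : int -> L).
Hypothesis bA : ladder b A.
Hypothesis consec : forall n, lie (A (n + 1)) (A n) = b.

(** These are the B_n of the Onsager algebra; under the two lext maps A_n
    and B_n both correspond to t^n, and the brackets become products of Laurent
    polynomials. *)
Definition rungB (n : int) : L := lie (A n) (A 0).

Lemma lext_lieAA p q : lie (lext A p) (lext A q) = lext rungB (p * linv q).
Proof.
move: p q; apply: laurent_bilinear_ext => [q|q|p|p|i j].
- by move=> a u v; rewrite linearP lieDl lieZl.
- by move=> a u v; rewrite mulrDl -scalerAl linearP.
- by move=> a u v; rewrite !linearP.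
- by move=> a u v; rewrite !linearP mulrDr -scalerAr linearP.
by rewrite linv_mon -lmonD !lext_mon (ladder_lieAA bA).
Qed.

Lemma lext_lieBA p q :
  lie (lext rungB p) (lext A q) = 2 *: lext A ((p - linv p) * q).
Proof.
move: p q; apply: laurent_bilinear_ext => [q|q|p|p|i j].
- by move=> a u v; rewrite linearP lieDl lieZl.
- move=> a u v; rewrite [linv _]linearP opprD addrACA -scalerBr mulrDl.
  by rewrite -scalerAl linearP scalerDr !scalerA mulrC.
- by move=> a u v; rewrite !linearP.
- move=> a u v; rewrite mulrDr -scalerAr linearP scalerDr !scalerA.
  by rewrite [2 * a]mulrC.
rewrite linv_mon mulrBl -!lmonD linearB /= !lext_mon (ladder_lieBA bA) //.
by rewrite (addrC i) (addrC (- i)).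
Qed.

Lemma lext_lieBB p q : lie (lext rungB p) (lext rungB q) = 0.
Proof.
apply: (@laurent_bilinear_ext _ _ (fun p q => lie (lext rungB p) (lext rungB q))
  (fun _ _ => 0)) => {p q} [q|q|p|p|i j].
- by move=> a u v; rewrite linearP lieDl lieZl.
- by move=> a u v; rewrite scaler0 addr0.
- by move=> a u v; rewrite !linearP.
- by move=> a u v; rewrite scaler0 addr0.
by rewrite !lext_mon (ladder_lieBB bA).
Qed.

Lemma lext_rungB_linv p : lext rungB (linv p) = - lext rungB p.
Proof.
move: p; apply: laurent_ind => [a u v|a u v|i]; first by rewrite !linearP.
  by rewrite linearP opprD scalerN.
rewrite linv_mon !lext_mon /rungB [in RHS]lieC opprK.
by rewrite (ladder_lieAA bA consec 0) sub0r.
Qed.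

End LadderSpan.

End CharZero.

(** * Symmetric Laurent polynomials *)

Section Chebyshev.
Variables (F : fieldType) (charF0 : [pchar F] =i pred0).

Lemma laurent_scale_nat n (a : laurent F) : (n%:R : F) *: a = n%:R * a.
Proof. by rewrite scaler_nat mulr_natl. Qed.

Fixpoint chebyshev (n : nat) : {poly F} :=
  match n with
  | 0 => 1
  | m.+1 => if m is k.+1 then 2 * 'X * chebyshev m - chebyshev k else 'X
  end.

Lemma chebyshevSS n :
  chebyshev n.+2 = 2 * 'X * chebyshev n.+1 - chebyshev n.
Proof. by []. Qed.

(** The linear map t^n |-> T_|n|(X).  It is a retraction of the embedding
    of F[X] as the algebra of symmetric Laurent polynomials, X |-> halfsum,
    and it is linear over that algebra. *)
Definition cheb_poly : laurent F -> {poly F} :=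
  lext (fun n => chebyshev `|n|%N).

HB.instance Definition _ :=
  GRing.Linear.copy cheb_poly (lext (fun n => chebyshev `|n|%N)).

Definition halfsum : laurent F := 2^-1 *: (tpos + tneg).

Lemma halfsum2 : 2 * halfsum = tpos + tneg.
Proof.
rewrite mulr_natl -scaler_nat scalerA divff ?scale1r //.
exact: (natr_neq0 charF0).
Qed.

Lemma cheb_poly_mon n : cheb_poly (lmon n) = chebyshev `|n|%N.
Proof. exact: lext_mon. Qed.

Lemma chebyshev_sum (n : int) :
  chebyshev (absz (n + 1)) + chebyshev (absz (n - 1))
  = 2 * 'X * chebyshev `|n|%N.
Proof.
case: n => [[|m]|m].
- rewrite add0r sub0r abszN /=; ring.
- have -> : Posz m.+1 - 1 = Posz m by rewrite intS addrC addKr.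
  have -> : Posz m.+1 + 1 = Posz m.+2 by rewrite [RHS]intS addrC.
  by rewrite !absz_nat chebyshevSS subrK.
have -> : Negz m - 1 = - Posz m.+2 by rewrite !NegzE [in RHS]intS opprD addrC.
have -> : Negz m + 1 = - Posz m by rewrite NegzE intS; ring.
by rewrite NegzE !abszN !absz_nat chebyshevSS addrC subrK.
Qed.

Lemma cheb_poly_halfsum p : cheb_poly (halfsum * p) = 'X * cheb_poly p.
Proof.
move: p; apply: laurent_ind => [a u v|a u v|n].
- by rewrite mulrDr -scalerAr linearP.
- by rewrite linearP mulrDr -scalerAr.
apply: (scalerI (natr_neq0 charF0 1)); rewrite -linearZ /= scalerAl scalerA.
rewrite divff ?(natr_neq0 charF0) // scale1r mulrDl -!lmonD linearD /=.
rewrite !cheb_poly_mon scaler_nat -mulr_natl mulrA -chebyshev_sum.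
by rewrite (addrC 1) (addrC (- 1)).
Qed.

Lemma cheb_poly_horner (p : {poly F}) q :
  cheb_poly (horner_alg halfsum p * q) = p * cheb_poly q.
Proof.
elim/poly_ind: p => [|p a IH]; first by rewrite linear0 !mul0r linear0.
rewrite linearD rmorphM /= horner_algX horner_algC mulrDl linearD /=.
rewrite -mulrA (mulrCA _ halfsum) cheb_poly_halfsum IH mulr_algl linearZ /=.
by rewrite mulrDl mul_polyC mulrCA mulrA.
Qed.

Lemma horner_chebyshev n :
  horner_alg halfsum (chebyshev n) = 2^-1 *: (lmon n%:Z + lmon (- n%:Z)).
Proof.
elim/ltn_ind: n => -[|[|n]] IH; [|by rewrite horner_algX|].
  rewrite rmorph1 oppr0 -mulr2n -scaler_nat scalerA.
  by rewrite mulVf ?scale1r ?(natr_neq0 charF0).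
rewrite chebyshevSS; move: (IH n (ltnW (ltnSn _))) (IH n.+1 (ltnSn _)).
move: (chebyshev n) (chebyshev n.+1) => p q pE qE.
rewrite rmorphB !rmorphM /= horner_algX rmorph_nat halfsum2 pE qE.
rewrite -scalerAr -scalerBr; congr (_ *: _).
rewrite mulrDl !mulrDr -!lmonD.
have -> : 1 + n.+1%:Z = n.+2 by [].
have -> : 1 - n.+1%:Z = - n%:Z by rewrite intS; ring.
have -> : -1 + n.+1%:Z = n by rewrite intS addKr.
have -> : -1 - n.+1%:Z = - n.+2%:Z by rewrite ![in RHS]intS intS; ring.
ring.
Qed.

Lemma horner_cheb_poly p :
  horner_alg halfsum (cheb_poly p) = 2^-1 *: (p + linv p).
Proof.
move: p; apply: laurent_ind => [a u v|a u v|n].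
- by rewrite (linearP cheb_poly) /= linearP /= mulr_algl.
- rewrite [linv _]linearP /=; combine F; ring.
rewrite cheb_poly_mon horner_chebyshev linv_mon.
by case: n => m; rewrite ?absz_nat // NegzE abszN absz_nat opprK addrC.
Qed.

Lemma cheb_poly_eval1 p : (cheb_poly p).[1] = leval1 p.
Proof.
move: p; apply: (@laurent_ind _ F^o) => [a u v|a u v|n].
- by rewrite linearP hornerD hornerZ.
- by rewrite linearP.
rewrite cheb_poly_mon leval1_mon; move: {n}`|n|%N => n.
elim/ltn_ind: n => -[|[|n]] IH; [exact: hornerC|exact: hornerX|].
rewrite chebyshevSS; move: (IH n (ltnW (ltnSn _))) (IH n.+1 (ltnSn _)).
move: (chebyshev n) (chebyshev n.+1) => p q p1 q1.
by rewrite !hornerE p1 q1; ring.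
Qed.

End Chebyshev.

(** * Normal forms for the given generators and relations *)

Section Models.
Variables (F : fieldType) (charF0 : [pchar F] =i pred0).
Variables (L : lieAlgType F) (gen : onsager_gen -> L).

Let x := gen gW0.
Let y := gen gW1.
Let g k := gen (gG k).

(** The elements A_n, H_k and Z_k attached to a family of elements indexed by
    the generators.  H_k, called antiG, is encoded by t c^k because
    lext (rungB rungA) only sees the antisymmetric part, here (t - 1/t) c^k. *)
Definition rungA : int -> L := full_ladder (lie y x) x y.
Definition antiG (k : nat) : L := lext (rungB rungA) (tpos * halfsum F ^+ k).
Definition symG (k : nat) : L := g k - antiG k.
Definition normal_form (p q : laurent F) (r : {poly F}) : L :=
  lext rungA p + lext (rungB rungA) q + pext symG r.

Lemma normal_form_gen (i : onsager_gen) :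
  gen i = match i with
          | gW0 => normal_form (lmon 0) 0 0
          | gW1 => normal_form (lmon 1) 0 0
          | gG k => normal_form 0 (tpos * halfsum F ^+ k) 'X^k
          end.
Proof.
case: i => [||k]; rewrite /normal_form.
- by rewrite !linear0 lext_mon !addr0.
- by rewrite !linear0 lext_mon !addr0.
by rewrite linear0 pext_Xn add0r addrC subrK.
Qed.

Lemma normal_formP a p q r p' q' r' :
  normal_form (a *: p + p') (a *: q + q') (a *: r + r')
  = a *: normal_form p q r + normal_form p' q' r'.
Proof. by rewrite /normal_form !linearP /=; combine F; ring. Qed.

Hypothesis gen_rel :
  forall u v, onsager_rel u v -> lie_eval gen u = lie_eval gen v.

Let bA : ladder (lie y x) rungA := full_ladderP charF0 _ _ _.

Let consec : forall n, lie (rungA (n + 1)) (rungA n) = lie y x.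
Proof.
have xxb : lie x (lie x (lie y x)) = 4 *: lie y x.
  have := gen_rel (rel_W0W0W0W1 F).
  by rewrite /= -/x -/y (lieC y x) !lieNr scalerN => ->.
exact: ladder_consecutive bA erefl xxb (gen_rel (rel_W1W1W1W0 F)).
Qed.

Let lieAA := lext_lieAA charF0 bA consec.
Let lieBA := lext_lieBA charF0 bA consec.
Let lieBB := lext_lieBB charF0 bA consec.

Let xE : x = lext rungA 1. Proof. by rewrite lext_mon. Qed.
Let yE : y = lext rungA tpos. Proof. by rewrite lext_mon. Qed.

Lemma linv_halfsum k : linv (halfsum F ^+ k) = halfsum F ^+ k.
Proof. exact: linv_half. Qed.

Lemma lext_rungB_sym p : linv p = p -> lext (rungB rungA) p = 0.
Proof.
move=> pE; apply: (scaler_nat_eq0 charF0 (n := 1)).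
have := lext_rungB_linv charF0 bA consec p; rewrite pE => /eqP.
by rewrite -addr_eq0 -mulr2n -scaler_nat => /eqP.
Qed.

(** In matrices, with h = (t - 1/t) c^k: [W_0, H_k] is off-diagonal with upper
    entry - 2 h, and its bracket with W_1 is diagonal with upper entry
    2 h (t + 1/t) = 4 c h. *)
Lemma antiG_step k : lie y (lie x (antiG k)) = 4 *: antiG k.+1.
Proof.
rewrite xE yE (lieC _ (antiG k)) lieBA mulr1 lieNr lieZr lieAA /antiG exprS.
have := linv_halfsum k; move: (halfsum F ^+ k) => q qE.
have -> : tpos * linv (tpos * q - linv (tpos * q)) = q - tpos * tpos * q.
  rewrite !(rmorphM, rmorphB) /= qE linv_tpos linv_tneg mulrBr !mulrA tposK.
  by rewrite mul1r qE.
have c2 : 2 *: (tpos * (halfsum F * q)) = tpos * tpos * q + q.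
  rewrite laurent_scale_nat mulrCA (mulrA 2) (halfsum2 charF0).
  by rewrite mulrA mulrDr tposK mulrDl mul1r.
have -> : 4 = 2 * 2 :> F by ring.
have := congr1 (lext (rungB rungA)) c2.
rewrite -scalerA linearZ /= => ->.
rewrite [lext _ (q - _)]linearB [lext _ (_ + q)]linearD /=.
by rewrite (lext_rungB_sym qE) add0r addr0 scalerN opprK.
Qed.

(** The order of W_0 and W_1 is immaterial because [W_1, W_0] = B_1 commutes
    with H_k. *)
Lemma antiG_step' k : lie x (lie y (antiG k)) = 4 *: antiG k.+1.
Proof.
rewrite -antiG_step [RHS]lie_leibniz.
suff -> : lie (lie y x) (antiG k) = 0 by rewrite add0r.
by rewrite {1}yE {1}xE lieAA lieBB.
Qed.

(** The defining relations express [W_1, G_{k+2}] and [G_{k+2}, W_0] through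
    the brackets of G_{k+1} with W_0 and W_1, which are those of H_k by
    induction; antiG_step turns them into the brackets of H_{k+1}. *)
Lemma symG_commutes_gens k : lie y (symG k) = 0 /\ lie x (symG k) = 0.
Proof.
elim: k => [|k [IHy IHx]].
  have -> : symG 0 = g 0 - lie y x.
    by rewrite /symG /antiG expr0 mulr1 lext_mon.
  have /= e1 := gen_rel (rel_W1W1W0 F); have /= e2 := gen_rel (rel_W1W0W0 F).
  by rewrite lieBr -e1 subrr lieC lieBl -e2 subrr oppr0.
have gkE z : lie z (symG k) = 0 -> lie z (g k) = lie z (antiG k).
  by move=> h; rewrite -(subrK (antiG k) (g k)) lieDr h add0r.
split; apply: (scaler_nat_eq0 charF0 (n := 3)).
  have := gen_rel (rel_W1W1W0G F k); rewrite /= -/x -/y -/(g _) -/(g _) gkE //.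
  by rewrite antiG_step lieZr lieBr scalerBr => ->; rewrite subrr.
have := gen_rel (rel_GW1W0W0 F k); rewrite /= -/x -/y -/(g _) -/(g _).
rewrite (lieC (g k)) gkE // !lieNl (lieC (lie y _)) lieNl opprK antiG_step'.
rewrite lieZl => e.
by rewrite lieC lieBl scalerN scalerBr -e subrr oppr0.
Qed.

Lemma symG_rungA k n : lie (symG k) (rungA n) = 0.
Proof.
have [zy zx] := symG_commutes_gens k.
have {}zy : lie (symG k) y = 0 by rewrite lieC zy oppr0.
have {}zx : lie (symG k) x = 0 by rewrite lieC zx oppr0.
have zb u : lie (symG k) u = 0 -> lie (symG k) (lie (lie y x) u) = 0.
  by move=> zu; rewrite !lie_commute.
elim/int_pair_ind: n => [||n z0 z1|n z0 z1]; [exact: zx|exact: zy| |].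
  by rewrite (ladder_up charF0 _ bA) lieDr lieZr z0 zb // scaler0 addr0.
by rewrite (ladder_down charF0 _ bA) lieBr lieZr z1 zb // scaler0 subr0.
Qed.

Lemma symG_lextA k p : lie (symG k) (lext rungA p) = 0.
Proof.
rewrite (linear_lext (symG_rungA k)) lextE big1 // => n _.
by rewrite scaler0.
Qed.

Lemma symG_lextB k p : lie (symG k) (lext (rungB rungA) p) = 0.
Proof.
have symG_rungB n : lie (symG k) (rungB rungA n) = 0.
  by apply: lie_commute; exact: symG_rungA.
rewrite (linear_lext symG_rungB) lextE big1 // => n _.
by rewrite scaler0.
Qed.

(** Only the G's are known to commute with each other.  Since Z_j and Z_k
    commute with H_j and H_k, and H_j with H_k, the brackets [Z_j, Z_k] and
    [G_{j+1}, G_{k+1}] agree. *)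
Lemma symG_symG j k : lie (symG j) (symG k) = 0.
Proof.
have gg : lie (g j) (g k) = 0 := gen_rel (rel_GG F j k).
rewrite {2}/symG lieBr symG_lextB subr0 lieBl gg sub0r (lieC (antiG j)).
rewrite -(subrK (antiG k) (g k)) lieDl symG_lextB lieBB addr0.
by rewrite opprK.
Qed.

Lemma pext_symG_central r p q s :
  lie (pext symG r) (normal_form p q s) = 0.
Proof.
have sym_pext k t : lie (symG k) (pext symG t) = 0.
  rewrite (linear_pext (symG_symG k)) /pext big1 // => i _.
  by rewrite scaler0.
have nf_symG k : lie (normal_form p q s) (symG k) = 0.
  by rewrite lieC !lieDr symG_lextA symG_lextB sym_pext !addr0 oppr0.
rewrite lieC (linear_pext nf_symG) /pext big1 ?oppr0 // => k _.
by rewrite scaler0.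
Qed.

Lemma normal_form_lie p q r p' q' r' :
  lie (normal_form p q r) (normal_form p' q' r')
  = normal_form (2 *: ((q - linv q) * p') - 2 *: ((q' - linv q') * p))
                (p * linv p') 0.
Proof.
rewrite {1}/normal_form lieDl pext_symG_central addr0.
rewrite {1}/normal_form (lieDr _ _ (pext symG r')) (lieC _ (pext symG r')).
have := pext_symG_central r' p q 0.
rewrite /normal_form !linear0 !addr0 => ->; rewrite oppr0 addr0.
rewrite lieDl !lieDr lieAA lieBA (lieC _ (lext (rungB _) q')) lieBA lieBB addr0.
by rewrite linearB !linearZ /=; combine F; ring.
Qed.

End Models.

Section Morphisms.
Variables (F : fieldType) (L M : lieAlgType F) (phi : {linear L -> M}).
Hypothesis phi_lie : lie_morphism phi.

Lemma lie_morphism_half_ladder b x y n :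
  phi (half_ladder b x y n) = half_ladder (phi b) (phi x) (phi y) n.
Proof.
elim: n x y => [//|n IH] x y /=.
by rewrite IH linearD linearZ /= phi_lie.
Qed.

Variables (gen : onsager_gen -> L) (gen' : onsager_gen -> M).
Hypothesis phi_gen : forall i, phi (gen i) = gen' i.

Lemma lie_morphism_rungA n : phi (rungA gen n) = rungA gen' n.
Proof.
by case: n => n; rewrite /rungA /full_ladder lie_morphism_half_ladder ?linearN;
  rewrite phi_lie !phi_gen.
Qed.

Lemma lie_morphism_lextB p :
  phi (lext (rungB (rungA gen)) p) = lext (rungB (rungA gen')) p.
Proof.
by apply: linear_lext => n; rewrite /rungB phi_lie !lie_morphism_rungA.
Qed.

Lemma lie_morphism_normal_form p q r :
  phi (normal_form gen p q r) = normal_form gen' p q r.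
Proof.
rewrite !linearD (linear_lext lie_morphism_rungA) lie_morphism_lextB.
congr (_ + _); apply: linear_pext => k.
by rewrite linearB /= phi_gen lie_morphism_lextB.
Qed.

End Morphisms.

(** * Matrices over Laurent polynomials *)

Section LoopMatrices.
Variable F : fieldType.
Implicit Types a b c d : laurent F.

Lemma loop_mx2_inj a b c d a' b' c' d' :
    mx2 a b c d = mx2 a' b' c' d' :> loop_gl2 F ->
  [/\ a = a', b = b', c = c' & d = d'].
Proof.
by move=> /matrixP e; split;
  [have := e 0 0|have := e 0 1|have := e 1 0|have := e 1 1]; rewrite !mxE.
Qed.

Lemma loop_mx2E (x : loop_gl2 F) : x = mx2 (x 0 0) (x 0 1) (x 1 0) (x 1 1).
Proof.
apply/matrixP => i j; rewrite mxE.
by case: i => [[|[|//]] Hi]; case: j => [[|[|//]] Hj] /=;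
  congr (x _ _); apply: val_inj.
Qed.

Lemma loop_addE a b c d a' b' c' d' :
  mx2 a b c d + mx2 a' b' c' d' = mx2 (a + a') (b + b') (c + c') (d + d')
    :> loop_gl2 F.
Proof. by apply/matrixP => i j; rewrite !mxE; do 2!case: ifP => _. Qed.

Lemma loop_subE a b c d a' b' c' d' :
  mx2 a b c d - mx2 a' b' c' d' = mx2 (a - a') (b - b') (c - c') (d - d')
    :> loop_gl2 F.
Proof. by apply/matrixP => i j; rewrite !mxE; do 2!case: ifP => _. Qed.

Lemma loop_scale_mx2 (k : F) a b c d :
  k *: (mx2 a b c d : loop_gl2 F) = mx2 (k *: a) (k *: b) (k *: c) (k *: d).
Proof. by apply/matrixP => i j; rewrite !mxE; do 2!case: ifP => _. Qed.

Lemma loop_lie_mx2 a b c d a' b' c' d' :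
  lie (mx2 a b c d : loop_gl2 F) (mx2 a' b' c' d')
  = mx2 (b * c' - b' * c) (a * b' + b * d' - a' * b - b' * d)
        (c * a' + d * c' - c' * a - d' * c) (c * b' - c' * b).
Proof.
rewrite [LHS](loop_mx2E (loop_lie _ _)) /loop_lie.
by congr mx2; rewrite !mxE !big_ord_recl !big_ord0 !mxE /=; ring.
Qed.

Lemma G_mxE k :
  G_mx F k = mx2 (halfsum F ^+ k * (2 * tpos - 2)) 0
                 0 (halfsum F ^+ k * (2 * tneg - 2)).
Proof. by rewrite /G_mx scale_mx2 !mulr0. Qed.

End LoopMatrices.

(** * The isomorphism *)

Section Presentation.
Variables (F : fieldType) (charF0 : [pchar F] =i pred0).

Local Notation O := (onsager F).
Local Notation P := (presented_lie (@onsager_rel F)).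

Lemma onsager_val_lie (x y : O) :
  onsager_val (lie x y) = lie (onsager_val x) (onsager_val y).
Proof. by []. Qed.

Lemma onsager_valZ k (x : O) : onsager_val (k *: x) = k *: onsager_val x.
Proof. by []. Qed.

Lemma onsager_rel_holds u v :
  onsager_rel u v -> lie_eval (@onsager_elt F) u = lie_eval (@onsager_elt F) v.
Proof.
(* Eliminating 1/t in favour of c leaves one relation, which rewrites t^2. *)
have negE : tneg = 2 * halfsum F - tpos.
  by rewrite (halfsum2 charF0) [_ + tneg]addrC addrK.
have pos2 : tpos * tpos = 2 * tpos * halfsum F - 1.
  transitivity (2 * tpos * halfsum F - tpos * (2 * halfsum F - tpos)).
    by ring.
  by rewrite -negE tposK.
case=> [||||k|k|k l]; apply: val_inj; last first.
  rewrite /= !G_mxE loop_lie_mx2 -[RHS]/(0 : 'M_2) [RHS]loop_mx2E !mxE.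
  by congr mx2; ring.
all: rewrite /= ?onsager_valZ ?onsager_val_lie /= ?G_mxE ?exprS ?expr0.
all: rewrite /W0_mx /W1_mx !loop_lie_mx2 ?loop_scale_mx2 negE.
all: by congr mx2; rewrite ?laurent_scale_nat; ring: pos2.
Qed.

(** This is t + 1/t - 2, the symmetric part of 2 t - 2. *)
Definition symmetric_factor : laurent F := 2 * (halfsum F - 1).

Lemma half_double (V : lmodType F) (v : V) : 2^-1 *: (2 *: v) = v.
Proof. by rewrite scalerA mulVf ?scale1r ?natr_neq0. Qed.

Local Notation genO := (@onsager_elt F).

Definition loop_gen (i : onsager_gen) : loop_gl2 F := onsager_val (genO i).

Lemma loop_ladder :
  ladder (lie (loop_gen gW1) (loop_gen gW0))
    (fun n => mx2 0 (lmon n) (lmon (- n)) 0 : loop_gl2 F).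
Proof.
move=> n; rewrite /= /W0_mx /W1_mx !loop_lie_mx2 loop_subE loop_scale_mx2.
rewrite opprD opprB (addrC 1) !lmonD -/tpos -/tneg.
by congr mx2; rewrite laurent_scale_nat; ring.
Qed.

Lemma loop_rungA n : rungA loop_gen n = mx2 0 (lmon n) (lmon (- n)) 0.
Proof.
by apply: (ladder_unique charF0 (full_ladderP charF0 _ _ _) loop_ladder).
Qed.

Lemma loop_lextA p : lext (rungA loop_gen) p = mx2 0 p (linv p) 0.
Proof.
move: p; apply: laurent_ind => [a u v|a u v|n]; first by rewrite linearP.
  rewrite loop_scale_mx2 loop_addE.
  by congr mx2; rewrite ?scaler0 ?addr0 ?linearP.
by rewrite lext_mon loop_rungA linv_mon.
Qed.

Lemma loop_lextB p :
  lext (rungB (rungA loop_gen)) p = mx2 (p - linv p) 0 0 (linv p - p).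
Proof.
move: p; apply: laurent_ind => [a u v|a u v|n]; first by rewrite linearP.
  rewrite loop_scale_mx2 loop_addE.
  congr mx2; rewrite ?scaler0 ?addr0 //.
    by rewrite [linv _]linearP /=; combine F; ring.
  by rewrite [linv _]linearP /=; combine F; ring.
rewrite lext_mon /rungB !loop_rungA loop_lie_mx2 linv_mon oppr0.
by rewrite -[lmon 0]/(1 : laurent F); congr mx2; ring.
Qed.

Lemma loop_symG k (d := symmetric_factor * halfsum F ^+ k) :
  symG loop_gen k = mx2 d 0 0 d.
Proof.
rewrite /symG /antiG loop_lextB [loop_gen _]G_mxE loop_subE /d.
rewrite rmorphM /= linv_halfsum linv_tpos.
have posE : tpos = 2 * halfsum F - tneg by rewrite halfsum2 // addrK.
by rewrite posE /symmetric_factor; congr mx2; ring.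
Qed.

Lemma loop_pextG r (d := symmetric_factor * horner_alg (halfsum F) r) :
  pext (symG loop_gen) r = mx2 d 0 0 d.
Proof.
rewrite {}/d; move: r; apply: poly_linear_ext => [a u v|a u v|k].
- by rewrite linearP.
- rewrite loop_scale_mx2 loop_addE linearP /= mulr_algl mulrDr -scalerAr.
  by rewrite !scaler0 !addr0.
by rewrite pext_Xn loop_symG rmorphXn /= horner_algX.
Qed.

(** Inclusion into the loop algebra is a Lie morphism, so that the normal form
    may be computed with matrices. *)
Lemma onsager_normal_form p q r
    (d := symmetric_factor * horner_alg (halfsum F) r) :
  onsager_val (normal_form genO p q r)
  = mx2 (q - linv q + d) p (linv p) (linv q - q + d).
Proof.
have val_lie : lie_morphism (\val : {linear O -> loop_gl2 F}) by [].
have -> : onsager_val (normal_form genO p q r) = normal_form loop_gen p q r.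
  exact: (lie_morphism_normal_form val_lie (fun=> erefl)).
rewrite /normal_form loop_lextA loop_lextB loop_pextG !loop_addE.
by congr mx2; rewrite ?add0r ?addr0.
Qed.

Local Notation genP := (pl_gen (@onsager_rel F)).

Lemma pl_class_eval u : pl_class (@onsager_rel F) u = lie_eval genP u.
Proof.
elim: u => //= [u <- v <-|u <-|a u <-|u <- v <-].
- by rewrite -pl_addE.
- by rewrite -pl_oppE.
- by rewrite -pl_scaleE.
by rewrite -pl_brE.
Qed.

Lemma genP_rel u v : onsager_rel u v -> lie_eval genP u = lie_eval genP v.
Proof. by move=> uv; rewrite -!pl_class_eval; apply/pl_classP/lc_rel. Qed.

Lemma presented_normal_form (x : P) : exists p q r, x = normal_form genP p q r.
Proof.
rewrite -(pl_reprK x) pl_class_eval.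
have nfP a u v : (exists p q r, u = normal_form genP p q r) ->
    (exists p q r, v = normal_form genP p q r) ->
    exists p q r, a *: u + v = normal_form genP p q r.
  move=> [p [q [r ->]]] [p' [q' [r' ->]]].
  by do 3!eexists; rewrite -normal_formP.
have nf0 : exists p q r, 0 = normal_form genP p q r.
  by exists 0, 0, 0; rewrite /normal_form !linear0 !addr0.
elim: (pl_repr x) => /= [i||u IHu v IHv|u IHu|a u IHu|u IHu v IHv].
- by rewrite normal_form_gen; case: i => [||k]; do 3!eexists.
- exact: nf0.
- by rewrite -[lie_eval _ u]scale1r; apply: nfP.
- by rewrite -[- _]addr0 -scaleN1r; apply: nfP.
- by rewrite -[_ *: _]addr0; apply: nfP.
case: IHu IHv => [p [q [r ->]]] [p' [q' [r' ->]]].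
by rewrite (normal_form_lie charF0 genP_rel); do 3!eexists.
Qed.

(** The antisymmetric part of the diagonal determines q only up to a symmetric
    summand, so the coordinates of an element of the presented algebra are not
    unique; but such a summand contributes nothing. *)
Lemma onsager_normal_form_eq0 p q r :
  normal_form genO p q r = 0 -> normal_form genP p q r = 0.
Proof.
move=> /(congr1 (@onsager_val F)); rewrite onsager_normal_form.
rewrite -[RHS]/(0 : 'M_2) [RHS]loop_mx2E !mxE => /loop_mx2_inj[a0 p0 _ d0].
set w := _ * _ in a0 d0.
have w0 : w = 0.
  apply: (scaler_nat_eq0 charF0 (n := 1)); rewrite -[RHS]addr0 -{1}a0 -d0.
  rewrite laurent_scale_nat; ring.
have r0 : r = 0.
  have := congr1 (@cheb_poly F) w0; rewrite linear0.
  have -> : w = horner_alg (halfsum F) (2 * ('X - 1) * r) * 1.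
    by rewrite mulr1 !rmorphM rmorphB /= horner_algX rmorph1 rmorph_nat.
  rewrite cheb_poly_horner // cheb_poly_mon mulr1 => /eqP.
  rewrite !mulf_eq0 polyXsubC_eq0 orbF => /orP[/eqP two0|/eqP //].
  have /eqP := congr1 (fun s : {poly F} => s.[0]) two0.
  by rewrite !hornerE (negPf (natr_neq0 charF0 1)).
have qE : linv q = q by apply/esym/subr0_eq; rewrite w0 addr0 in a0.
rewrite /normal_form p0 r0 !linear0 addr0 add0r.
exact: (lext_rungB_sym charF0 genP_rel qE).
Qed.

Lemma leval1_linv (p : laurent F) : leval1 (linv p) = leval1 p.
Proof.
move: p; apply: laurent_ind => [a u v|a u v|n]; rewrite ?linearP //.
by rewrite linv_mon !leval1_mon.
Qed.

(** The inverse isomorphism.  The diagonal entry a is the sum of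
    a/2 - a^*/2, which is what lext (rungB rungA) sees of a/2, and of
    (a + a^* )/2, which is cheb_poly a evaluated at c.  As cheb_poly a vanishes
    at 1, the latter is (2c - 2) times half of the quotient by X - 1,
    evaluated at c. *)
Definition onsager_coordinates (x : O) : P :=
  normal_form genP (onsager_val x 0 1) (2^-1 *: onsager_val x 0 0)
    (2^-1 *: (cheb_poly (onsager_val x 0 0) %/ ('X - 1%:P))).

Lemma onsager_coordinatesK x :
  normal_form genO (onsager_val x 0 1) (2^-1 *: onsager_val x 0 0)
    (2^-1 *: (cheb_poly (onsager_val x 0 0) %/ ('X - 1%:P))) = x.
Proof.
apply: val_inj; rewrite [LHS]onsager_normal_form /= [RHS]loop_mx2E.
have /onsager_predP[eps0] := valP x.
rewrite /= /theta [RHS]loop_mx2E => /loop_mx2_inj [_ _ cE dE].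
set a := onsager_val x 0 0 in dE *; set d := onsager_val x 1 1 in dE *.
have a1 : leval1 a = 0.
  apply: (scaler_nat_eq0 charF0 (n := 1) (V := F^o)); rewrite scaler_nat mulr2n.
  by rewrite -[RHS]eps0 /eps -/a -/d -dE leval1_linv.
set r := cheb_poly a %/ _.
have rE : cheb_poly a = r * ('X - 1%:P).
  by rewrite divpK // dvdp_XsubCl /root cheb_poly_eval1 a1.
have symE : symmetric_factor * horner_alg (halfsum F) (2^-1 *: r)
    = 2^-1 *: (a + linv a).
  rewrite -horner_cheb_poly // rE rmorphM rmorphB /= horner_algX horner_algC.
  rewrite linearZ /= mulr_algl -scalerAr scale1r /symmetric_factor.
  by rewrite -[RHS]half_double laurent_scale_nat mulrA mulrAC mulrC.
rewrite symE -dE -cE; congr mx2; rewrite [linv (_ *: _)]linearZ /=.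
  by combine F; field; exact: (natr_neq0 charF0 1).
by combine F; field; exact: (natr_neq0 charF0 1).
Qed.

Lemma onsager_presentation :
  has_presentation (@onsager_rel F) (@onsager_elt F).
Proof.
have [phi [phi_lie phi_gen _]] := pl_universal onsager_rel_holds.
exists phi; split=> //.
have phi_nf := lie_morphism_normal_form phi_lie phi_gen.
have phi_ker x : phi x = 0 -> x = 0.
  have [p [q [r ->]]] := presented_normal_form x.
  by rewrite phi_nf; apply: onsager_normal_form_eq0.
have phi_inj : injective phi by exact: raddf_inj phi_ker.
have coordK x : phi (onsager_coordinates x) = x.
  by rewrite /onsager_coordinates phi_nf onsager_coordinatesK.
by exists onsager_coordinates => // x; apply: phi_inj; rewrite coordK.
Qed.

End Presentation.

Theorem lemma4p22 (F : fieldType) (charF0 : [pchar F]%R =i pred0) :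
  has_presentation (@onsager_rel F) (@onsager_elt F).
Proof. exact: onsager_presentation. Qed.
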